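(* Let $F$ be an arbitrary field of characteristic $\ell$, let $V$ be a non-zero finite dimensional vector space over $F$, and let $f:V\times V\to F$ be a bilinear form. Then the Lie algebra $L(f)$ is simple if and only if $\ell\neq 2$, $f$ is non-degenerate and exactly one of the following conditions holds: (1) $f$ is skew-symmetric; (2) $f$ is symmetric, $\dim(V)>2$, and if $\dim(V)=4$ then the discriminant of $f$ is not a square in $F$; (3) $f=f_1\perp f_{-1}$, where $f_1$ is symmetric, $f_{-1}$ is skew-symmetric, $\dim(V_1)=1$ and $\dim(V_{-1})>0$.
   Context: $L(f)=\{x\in\mathfrak{gl}(V)\mid f(xv,w)=-f(v,xw)\ \text{for all } v,w\in V\}$. Simple means non-abelian with no ideals other than $0$ and the whole algebra. The discriminant of a non-degenerate symmetric form is the determinant of a Gram matrix, well defined up to non-zero squares (in dimension 4 no sign is involved). If $f$ is non-degenerate, its asymmetry $\sigma\in\mathrm{GL}(V)$ is defined by $f(w,v)=f(v,\sigma w)$ for all $v,w\in V$. For $\lambda\in F$, $V_\lambda=\{v\in V\mid (\sigma-\lambda)^m v=0\text{ for some } m\ge1\}$, and for $\lambda=\pm1$, $f_{\lambda}$ denotes the restriction of $f$ to $V_{\lambda}$. The notation $f=f_1\perp f_{-1}$ means $V=V_1\oplus V_{-1}$ with $f(V_1,V_{-1})=0=f(V_{-1},V_1)$. *)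

(* Defs.v *)
From HB Require Import structures.
From mathcomp Require Import all_boot all_order all_algebra.

Set Implicit Arguments.
Unset Strict Implicit.
Unset Printing Implicit Defensive.

Import GRing.Theory.
Local Open Scope ring_scope.

Section LieAlgebra.
Variables (F : fieldType) (V : vectType F).
Implicit Types (L : 'End(V) -> Prop) (I : {vspace 'End(V)}).

Definition lie_bracket (x y : 'End(V)) : 'End(V) := (x \o y)%VF - (y \o x)%VF.

(* [L] is meant to be a Lie subalgebra of gl(V), given by its membership
   predicate. *)
Definition lie_abelian L := forall x y, L x -> L y -> lie_bracket x y = 0.

Definition lie_ideal L I :=
  (forall x, x \in I -> L x) /\
  (forall x y, L x -> y \in I -> lie_bracket x y \in I).

Definition lie_simple L :=
  ~ lie_abelian L /\
  (forall I, lie_ideal L I -> I = 0%VS \/ (forall x, L x -> x \in I)).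

End LieAlgebra.

Section BilinearForm.
Variables (F : fieldType) (V : vectType F) (f : {biscalar V}).

Definition form_lie_algebra (x : 'End(V)) : Prop :=
  forall v w, f (x v) w = - f v (x w).

Definition form_nondegenerate :=
  (forall v, (forall w, f v w = 0) -> v = 0) /\
  (forall w, (forall v, f v w = 0) -> w = 0).

Definition form_symmetric := forall v w, f v w = f w v.

Definition form_skew := forall v w, f v w = - f w v.

Definition gram n (e : n.-tuple V) : 'M[F]_n := \matrix_(i, j) f e`_i e`_j.

(* Only meaningful up to nonzero squares, see [discriminant_basis]. *)
Definition discriminant : F := \det (gram (vbasis {:V})).

Definition is_asymmetry (s : 'End(V)) := forall v w, f w v = f v (s w).

End BilinearForm.

Section GeneralizedEigenspace.
Variables (F : fieldType) (V : vectType F).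

Definition generalized_eigenvector (s : 'End(V)) (lambda : F) (v : V) :=
  exists2 m, (0 < m)%N & iter m (fun u => s u - lambda *: u) v = 0.

(* W = V_lambda; such a W exists and is unique, see
   [generalized_eigenspace_exists] and [generalized_eigenspace_unique]. *)
Definition is_generalized_eigenspace (s : 'End(V)) (lambda : F)
    (W : {vspace V}) :=
  forall v, v \in W <-> generalized_eigenvector s lambda v.

End GeneralizedEigenspace.

Definition is_square (F : fieldType) (a : F) := exists b, a = b ^+ 2.

Section Conditions.
Variables (F : fieldType) (V : vectType F) (f : {biscalar V}).

Definition symmetric_condition :=
  [/\ form_symmetric f, (2 < \dim {:V})%N
    & \dim {:V} = 4%N -> ~ is_square (discriminant f)].

(* W1 and Wm1 are the spaces V_1 and V_{-1} of the asymmetry s, which exists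
   and is unique for non-degenerate f, see [asymmetry_exists] and
   [asymmetry_unique]. *)
Definition mixed_condition :=
  exists (s : 'End(V)) (W1 Wm1 : {vspace V}),
    [/\ is_asymmetry f s,
        is_generalized_eigenspace s 1 W1
      & is_generalized_eigenspace s (-1) Wm1] /\
    [/\ (W1 + Wm1 = {:V})%VS, directv (W1 + Wm1),
        {in W1 & Wm1, forall v w, f v w = 0}
      & {in Wm1 & W1, forall v w, f v w = 0}] /\
    [/\ {in W1 &, form_symmetric f}, {in Wm1 &, form_skew f},
        \dim W1 = 1%N & (0 < \dim Wm1)%N].

End Conditions.

Definition exactly_one_of_three (P Q R : Prop) :=
  [\/ [/\ P, ~ Q & ~ R], [/\ ~ P, Q & ~ R] | [/\ ~ P, ~ Q & R]].

Section Facts.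
Variables (F : fieldType) (V : vectType F) (f : {biscalar V}).

Lemma form_lie_algebra_linear (a : F) (x y : 'End(V)) :
  form_lie_algebra f x -> form_lie_algebra f y ->
  form_lie_algebra f (a *: x + y).
Proof.
move=> Lx Ly v w; rewrite !add_lfunE !scale_lfunE.
by rewrite linearDl linearDr linearZl_LR linearZr_LR /= Lx Ly mulrN opprD.
Qed.

Lemma form_lie_algebra_bracket (x y : 'End(V)) :
  form_lie_algebra f x -> form_lie_algebra f y ->
  form_lie_algebra f (lie_bracket x y).
Proof.
move=> Lx Ly v w.
rewrite /lie_bracket !add_lfunE !opp_lfunE !comp_lfunE.
rewrite linearBl linearBr /= !Lx !Ly !Lx !opprK.
by rewrite opprB.
Qed.

Lemma discriminant_basis (e : (\dim {:V}).-tuple V) : basis_of {:V} e ->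
  exists2 c, c != 0 & \det (gram f e) = c ^+ 2 * discriminant f.
Proof.
move=> eB; set b := vbasis {:V}.
pose P := \matrix_(i, j) coord b j e`_i : 'M[F]_(\dim {:V}).
pose Q := \matrix_(i, j) coord e j b`_i : 'M[F]_(\dim {:V}).
have eP i : e`_i = \sum_j coord b j e`_i *: b`_j.
  by apply: coord_basis; [exact: vbasisP | exact: memvf].
have PQ : P *m Q = 1%:M.
  apply/matrixP=> i j; rewrite !mxE.
  under eq_bigr do rewrite !mxE.
  transitivity (coord e j e`_i); last by rewrite coord_free ?(basis_free eB).
  by rewrite {2}(eP i) linear_sum; apply: eq_bigr => k _; rewrite linearZ.
exists (\det P).
  apply/eqP => dP; move: (congr1 determinant PQ).
  by rewrite det_mulmx dP mul0r det1 => /eqP; rewrite eq_sym oner_eq0.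
have -> : gram f e = P *m gram f b *m P^T.
  apply/matrixP=> i j; rewrite !mxE {1}(eP i) (eP j) linear_sumr.
  apply: eq_bigr => k _; rewrite linear_sumlz !mxE mulr_suml.
  by apply: eq_bigr => l _; rewrite linearZl_LR linearZr_LR !mxE /= mulrCA mulrC.
by rewrite !det_mulmx det_tr expr2 mulrAC.
Qed.

Lemma asymmetry_unique (s t : 'End(V)) : form_nondegenerate f ->
  is_asymmetry f s -> is_asymmetry f t -> s = t.
Proof.
move=> [_ nd] sP tP; apply/lfunP=> w; apply/eqP; rewrite -subr_eq0.
by apply/eqP/nd => v; rewrite linearBr /= -sP -tP subrr.
Qed.

Lemma asymmetry_exists : form_nondegenerate f ->
  exists2 s : 'End(V), is_asymmetry f s & lker s == 0%VS.
Proof.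
move=> [ndl ndr]; pose b := vbasis {:V}.
have ext v w v' w' : (forall i : 'I_(\dim {:V}), f b`_i w = f w' b`_i) ->
    v = v' -> f v w = f w' v'.
  move=> h <-; rewrite (coord_basis (vbasisP _) (memvf v)).
  rewrite linear_sumlz linear_sumr; apply: eq_bigr => i _.
  by rewrite linearZl_LR linearZr_LR /= h.
pose p u : 'rV[F]_(\dim {:V}) := \row_i f b`_i u.
pose q u : 'rV[F]_(\dim {:V}) := \row_i f u b`_i.
have pL : linear p.
  by move=> a u v; apply/rowP=> i; rewrite !mxE linearDr linearZr_LR.
have qL : linear q.
  by move=> a u v; apply/rowP=> i; rewrite !mxE linearDl linearZl_LR.
pose pH := GRing.isLinear.Build _ _ _ _ p pL.
pose qH := GRing.isLinear.Build _ _ _ _ q qL.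
pose p' : {linear V -> 'rV[F]_(\dim {:V})} := HB.pack p pH.
pose q' : {linear V -> 'rV[F]_(\dim {:V})} := HB.pack q qH.
have pK : lker (linfun p') == 0%VS.
  apply/eqP/vspaceP => u; rewrite memv_ker memv0 lfunE /=.
  apply/eqP/eqP=> [pu0|->]; last exact: (linear0 p').
  apply: ndr => v; transitivity (f 0 v); last by rewrite linear0l.
  by apply: ext => // i; move/rowP: pu0 => /(_ i); rewrite !mxE linear0l.
have pS : limg (linfun p') = fullv.
  apply/eqP; rewrite eqEdim subvf /= limg_dim_eq; last first.
    by rewrite (eqP pK) capv0.
  by rewrite !dimvf /dim /= mul1n.
pose s := ((linfun p')^-1 \o linfun q')%VF.
have sP : is_asymmetry f s.
  move=> v w; apply/esym/ext => // i.
  have : linfun p' (s w) = linfun q' w.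
    by rewrite comp_lfunE limg_lfunVK // pS memvf.
  by rewrite !lfunE /= => /rowP/(_ i); rewrite !mxE.
exists s => //; apply/eqP/vspaceP => u; rewrite memv_ker memv0.
apply/eqP/eqP=> [su|->]; last exact: linear0.
by apply: ndl => w; rewrite sP su linear0r.
Qed.

Lemma generalized_eigenspace_unique (s : 'End(V)) lambda (W W' : {vspace V}) :
  is_generalized_eigenspace s lambda W ->
  is_generalized_eigenspace s lambda W' -> W = W'.
Proof.
by move=> h h'; apply/vspaceP=> v; apply/idP/idP=> [/h/h'|/h'/h].
Qed.

Lemma generalized_eigenspace_exists (s : 'End(V)) lambda :
  exists W, is_generalized_eigenspace s lambda W.
Proof.
pose g : 'End(V) := s - lambda *: \1%VF.
have gE u : g u = s u - lambda *: u by rewrite /g add_lfunE opp_lfunE scale_lfunE id_lfunE.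
pose G m : 'End(V) := iter m (fun h => (g \o h)%VF) \1%VF.
have GE m v : G m v = iter m (fun u => s u - lambda *: u) v.
  by elim: m => [|m IH]; rewrite /= ?id_lfunE // comp_lfunE IH gE.
have K1 m : (lker (G m) <= lker (G m.+1))%VS.
  apply/subvP=> v; rewrite !memv_ker /= comp_lfunE => /eqP->.
  by rewrite linear0.
have Km m k : (lker (G m) <= lker (G (k + m)%N))%VS.
  by elim: k => [|k IH]; [exact: subvv | exact: subv_trans IH (K1 _)].
have stab m : lker (G m) = lker (G m.+1) ->
    forall k, (lker (G (k + m)%N) <= lker (G m))%VS.
  move=> Em; elim=> [|k IH]; first exact: subvv.
  apply/subvP=> v; rewrite memv_ker GE iterSr -GE -memv_ker => h.
  by rewrite Em memv_ker GE iterSr -GE -memv_ker (subvP IH).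
have [m Em] : exists m, lker (G m) = lker (G m.+1).
  have H n : (exists m, lker (G m) = lker (G m.+1)) \/ (n <= \dim (lker (G n)))%N.
    elim: n => [|n [|IH]]; [by right | by left |].
    have [E|N] := eqVneq (lker (G n)) (lker (G n.+1)); first by left; exists n.
    right; apply: leq_ltn_trans IH _.
    by rewrite ltnNge; apply: contra N => h; rewrite eqEdim K1.
  have [//|] := H (\dim {:V}).+1.
  by rewrite leqNgt ltnS dimvS ?subvf.
exists (lker (G m)) => v; split.
  by move=> h; exists m.+1 => //; rewrite -GE; apply/eqP; rewrite -memv_ker -Em.
case=> k _; rewrite -GE => /eqP; rewrite -memv_ker => h.
by apply: (subvP (stab m Em k)); rewrite addnC (subvP (Km k m)).
Qed.

End Facts.

(* Main.v *)
Require Import Defs.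
From HB Require Import structures.
From mathcomp Require Import all_boot all_order all_algebra.
From mathcomp Require Import ring.
From Stdlib Require Import Classical.
Import GRing.Theory.
Local Open Scope ring_scope.

Set Implicit Arguments.
Unset Strict Implicit.
Unset Printing Implicit Defensive.

(** For any [a b : V] the operator [rank2 f a b], mapping [v] to
[f b v *: a - f v a *: b], satisfies [[y, rank2 a b] = rank2 (y a) b +
rank2 a (y b)] for every [y] in [L(f)], and it lies in [L(f)] as soon as [f] is
symmetric at both [a] and [b], or skew at both, or if [a] is in the left and [b]
in the right radical ([rank2_in]).  These operators carry the whole argument.

Suppose [L(f)] is simple.
- In characteristic 2 the identity is a central element of [L(f)], so the
  characteristic is not 2.
- Assume [f] degenerate.  Ideals of operators of [L(f)] that map [V] into an
  invariant subspace [M] and kill [M] are abelian, hence zero; with [M] the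
  intersection of the two radicals, this shows that the radicals meet trivially
  (for [f = 0] the identity is central).
  If [a] is in the left and [b] in the right radical then [rank2 a b] is in
  [L(f)], and its trace on the left radical is [f b a].  A simple algebra is
  perfect, so that trace is zero and the radicals are orthogonal; then
  [rank2 a b] maps [V] into the sum of the radicals and kills it, so it is zero,
  which is absurd ([simple_nondegenerate]).
- For nondegenerate [f] with asymmetry [s], the operator [s - s^-1] is a central
  element of [L(f)].  So [s] is an involution and [V] is the orthogonal sum of a
  subspace on which [f] is symmetric and one on which [f] is skew.  [L(f)] is the
  product of the corresponding orthogonal and symplectic algebras, one of which
  has to vanish ([simple_trichotomy]).
- If [f] is symmetric, an orthogonal basis shows that [L(f)] is abelian in
  dimension at most 2, and that in dimension 4 with discriminant [c ^+ 2] three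
  linear equations define a nonzero proper ideal, an eigenspace of the Hodge star
  ([orthogonal4_not_simple]).

Conversely, when [f] is symmetric or skew on the subspace where [L(f)] acts, the
operators [rank2 a b] span [L(f)] ([rank2_span]), and it is enough that a nonzero
ideal contains all of them.  In the skew case brackets with the [rank2 a a]
produce one of these and then all ([symplectic_simple]).  In the symmetric case
let [T i j] be [rank2] of two members of an orthogonal basis.  Up to a nonzero
scalar, the square of [ad (T p q)] is the projection on the pairs of indices that
meet [{p, q}] in one index; products of such projections isolate one pair, except
in dimension 4, where a pair and its complement stay together and can be
separated precisely when the discriminant is not a square ([ideal_rank2]). *)

(** * Linear algebra *)

(** Lets ideals and subspaces be given by predicates: starting from [0], a
subspace contained in the predicate that misses one of its members can be
enlarged, and this stops because dimensions are bounded. *)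
Lemma closed_predicate_vspace (F : fieldType) (vT : vectType F)
    (P : vT -> Prop) :
  P 0 -> (forall a u v, P u -> P v -> P (a *: u + v)) ->
  exists W : {vspace vT}, forall v, v \in W <-> P v.
Proof.
move=> P0 Plin.
have step n : (exists W : {vspace vT}, forall v, v \in W <-> P v) \/
    (exists2 W : {vspace vT}, (forall v, v \in W -> P v) & (n <= \dim W)%N).
  elim: n => [|n [|[W WP dimW]]]; [|by left|].
    by right; exists 0%VS => // v; rewrite memv0 => /eqP->.
  have [PW|/not_all_ex_not[v]] := classic (forall v, P v -> v \in W).
    by left; exists W => v; split=> [/WP|/PW].
  move=> /(@imply_to_and (P v)) [Pv /negP vW].
  right; exists (<[v]> + W)%VS.
    by move=> _ /memv_addP[_ /vlineP[a ->] [w /WP Pw ->]]; apply: Plin.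
  apply: leq_ltn_trans dimW _; rewrite ltnNge; apply: contra vW => le.
  have /eqP-> : W == (<[v]> + W)%VS by rewrite eqEdim addvSr.
  by rewrite (subvP (addvSl _ _)) ?memv_line.
have [//|[W _]] := step (\dim {:vT}).+1.
by rewrite leqNgt ltnS dimvS ?subvf.
Qed.

Lemma basis_ind (F : fieldType) (vT : vectType F) n (e : n.-tuple vT) 
    (U : {vspace vT}) (P : vT -> Prop) :
  basis_of U e -> P 0 -> (forall a u v, P u -> P v -> P (a *: u + v)) ->
  (forall i : 'I_n, P e`_i) -> forall v, v \in U -> P v.
Proof.
move=> eU P0 Plin Pe v /(coord_basis eU)->.
elim: (index_enum _) => [|i r IH]; first by rewrite big_nil.
by rewrite big_cons; apply: Plin.
Qed.

Lemma eq_opp_eq0 (F : fieldType) (c : F) : (2 : F) != 0 -> c = - c -> c = 0.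
Proof.
move=> two0 /eqP; rewrite -subr_eq0 opprK -mulr2n -mulr_natl mulf_eq0.
by rewrite (negPf two0) => /eqP.
Qed.

(** * Ideals of a simple Lie algebra *)

Section Bracket.
Variables (F : fieldType) (V : vectType F).
Implicit Types (x y z : 'End(V)) (L P : 'End(V) -> Prop).

Lemma lie_bracketE x y v : lie_bracket x y v = x (y v) - y (x v).
Proof. by rewrite /lie_bracket add_lfunE opp_lfunE !comp_lfunE. Qed.

Lemma lie_bracketC x y : lie_bracket x y = - lie_bracket y x.
Proof. by rewrite /lie_bracket opprB. Qed.

Lemma lie_bracketDr x y z :
  lie_bracket x (y + z) = lie_bracket x y + lie_bracket x z.
Proof.
apply/lfunP => v; rewrite !(add_lfunE, lie_bracketE) linearD opprD addrACA.
by [].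
Qed.

Lemma lie_bracketZr a x y : lie_bracket x (a *: y) = a *: lie_bracket x y.
Proof.
by apply/lfunP => v; rewrite !(scale_lfunE, lie_bracketE) linearZ /= scalerBr.
Qed.

(** An ideal is most easily exhibited by a condition on operators, which
[closed_predicate_vspace] turns into a subspace. *)
Lemma simple_ideal L P : lie_simple L ->
  (forall x, P x -> L x) -> P 0 ->
  (forall a x y, P x -> P y -> P (a *: x + y)) ->
  (forall x y, L x -> P y -> P (lie_bracket x y)) ->
  (forall x, P x -> x = 0) \/ (forall x, L x -> P x).
Proof.
move=> [_ simL] PL P0 Plin Pbr.
have [I IP] := closed_predicate_vspace P0 Plin.
have [|I0|LI] := simL I.
- split=> [x /IP/PL//|x y Lx /IP Py]; by apply/IP/Pbr.
- by left=> x /IP; rewrite I0 memv0 => /eqP.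
- by right=> x /LI/IP.
Qed.

(** A central element spans an ideal; if that ideal were everything the algebra
would be abelian. *)
Lemma simple_center L z : lie_simple L -> L 0 ->
  (forall a x y, L x -> L y -> L (a *: x + y)) ->
  L z -> (forall x, L x -> lie_bracket x z = 0) -> z = 0.
Proof.
move=> simL L0 Llin Lz zC; have Lmul a : L (a *: z).
  by rewrite -[a *: z]addr0; apply: Llin.
have [||||h|h] := @simple_ideal L (fun x => exists a, x = a *: z) simL.
- by move=> _ [a ->].
- by exists 0; rewrite scale0r.
- by move=> a _ _ [b ->] [c ->]; exists (a * b + c); rewrite scalerDl scalerA.
- move=> x _ Lx [a ->]; exists 0.
  by rewrite scale0r lie_bracketZr zC // scaler0.
- by apply: h; exists 1; rewrite scale1r.
- case: simL => nab _; case: nab => x y Lx /h[a ->].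
  by rewrite lie_bracketZr zC // scaler0.
Qed.

End Bracket.

(** * The operators of rank two *)

Section Form.
Variables (F : fieldType) (V : vectType F) (f : {biscalar V}).
Local Notation L := (form_lie_algebra f).
Implicit Types (x y : 'End(V)) (a b u v w : V) (U W : {vspace V}).

Lemma form_lie_algebra0 : L 0.
Proof. by move=> v w; rewrite !zero_lfunE linear0l linear0r oppr0. Qed.

Lemma form_lie_algebraZ c x : L x -> L (c *: x).
Proof.
by move=> Lx; rewrite -[c *: x]addr0; apply: form_lie_algebra_linear form_lie_algebra0.
Qed.

Lemma form_center z : lie_simple L -> L z ->
  (forall x, L x -> lie_bracket x z = 0) -> z = 0.
Proof.
by move=> simL; apply: simple_center simL form_lie_algebra0 _;
apply: form_lie_algebra_linear.
Qed.

Definition rank2_fun a b v : V := f b v *: a - f v a *: b.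

Fact rank2_fun_is_linear a b : linear (rank2_fun a b).
Proof.
move=> c u v; rewrite /rank2_fun linearDr linearDl linearZr_LR linearZl_LR /=.
by rewrite !scalerDl -!scalerA scalerBr opprD addrACA.
Qed.

HB.instance Definition _ a b :=
  GRing.isLinear.Build F V V *:%R (rank2_fun a b) (rank2_fun_is_linear a b).

Definition rank2 a b : 'End(V) := linfun (rank2_fun a b).

Lemma rank2E a b v : rank2 a b v = f b v *: a - f v a *: b.
Proof. by rewrite lfunE. Qed.

(** The hypothesis has this form in order to cover at once [f] symmetric at both
[a] and [b], [f] skew at both, [a] in the left and [b] in the right radical, and
[a] in both radicals with [b] arbitrary. *)
Lemma rank2_in a b :
  (forall v w, f a w * f b v = f w a * f v b) -> L (rank2 a b).
Proof.
move=> fab v w; rewrite !rank2E linearBl linearBr /= !linearZl_LR !linearZr_LR /=.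
have := fab v w; rewrite [f b v * _]mulrC => ->; ring.
Qed.

(** Hence the [rank2 a b], with [a] and [b] in invariant subspaces, span an ideal. *)
Lemma rank2_bracket y a b : L y ->
  lie_bracket y (rank2 a b) = rank2 (y a) b + rank2 a (y b).
Proof.
move=> Ly; apply/lfunP => v; rewrite lie_bracketE add_lfunE !rank2E.
have yb : f b (y v) = - f (y b) v by rewrite Ly opprK.
rewrite linearB !linearZ /= (Ly v a) yb !scaleNr !scalerN !opprK opprD opprK.
by rewrite addrACA [RHS]addrACA [- (f v a *: _) + _]addrC.
Qed.

Lemma rank2Dl c a a' b : rank2 (c *: a + a') b = c *: rank2 a b + rank2 a' b.
Proof.
apply/lfunP => v; rewrite add_lfunE scale_lfunE !rank2E linearDr linearZr_LR /=.
rewrite scalerDr scalerDl scalerBr !scalerA [f b v * c]mulrC opprD.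
by rewrite addrACA.
Qed.

Lemma rank2Dr c a b b' : rank2 a (c *: b + b') = c *: rank2 a b + rank2 a b'.
Proof.
apply/lfunP => v; rewrite add_lfunE scale_lfunE !rank2E linearDl linearZl_LR /=.
rewrite scalerDr scalerDl scalerBr !scalerA [f v a * c]mulrC opprD.
by rewrite addrACA.
Qed.

Lemma rank2_0l b : rank2 0 b = 0.
Proof. by have := rank2Dl (-1) 0 0 b; rewrite scaler0 addr0 scaleN1r addNr. Qed.

Lemma rank2_0r a : rank2 a 0 = 0.
Proof. by have := rank2Dr (-1) a 0 0; rewrite scaler0 addr0 scaleN1r addNr. Qed.

Lemma rank2Zl c a b : rank2 (c *: a) b = c *: rank2 a b.
Proof. by rewrite -[c *: a]addr0 rank2Dl rank2_0l addr0. Qed.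

Lemma rank2Zr c a b : rank2 a (c *: b) = c *: rank2 a b.
Proof. by rewrite -[c *: b]addr0 rank2Dr rank2_0r addr0. Qed.

Lemma rank2Al a a' b : rank2 (a + a') b = rank2 a b + rank2 a' b.
Proof. by rewrite -[a]scale1r rank2Dl !scale1r. Qed.

Lemma rank2Ar a b b' : rank2 a (b + b') = rank2 a b + rank2 a b'.
Proof. by rewrite -[b]scale1r rank2Dr !scale1r. Qed.

(** * Invariant subspaces and traces *)

Definition left_radical v := forall w, f v w = 0.
Definition right_radical w := forall v, f v w = 0.

(** The operators mapping [V] into [M] and killing [M] form an ideal; as the
product of any two of them is zero, this ideal is abelian. *)
Lemma simple_null_ideal (M : {vspace V}) x :
  lie_simple L -> (forall y v, L y -> v \in M -> y v \in M) ->
  L x -> (forall v, x v \in M) -> (forall v, v \in M -> x v = 0) -> x = 0.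
Proof.
move=> simL LM Lx xV xM.
have [||||h|h] := @simple_ideal F V L
  (fun x => [/\ L x, forall v, x v \in M & forall v, v \in M -> x v = 0]) simL.
- by move=> y [].
- split=> [|v|v _]; first exact: form_lie_algebra0.
    by rewrite zero_lfunE mem0v.
  by rewrite zero_lfunE.
- move=> c y z [Ly yV yM] [Lz zV zM]; split=> [|v|v vM].
  + exact: form_lie_algebra_linear.
  + by rewrite add_lfunE scale_lfunE memvD ?memvZ.
  + by rewrite add_lfunE scale_lfunE yM ?zM // scaler0 addr0.
- move=> y z Ly [Lz zV zM]; split=> [|v|v vM].
  + exact: form_lie_algebra_bracket.
  + by rewrite lie_bracketE; apply: memvB; [apply: LM|].
  + by rewrite lie_bracketE (zM v) // (zM (y v)) ?LM // linear0 subrr.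
- exact: h.
case: simL => nab _; case: nab => y z /h[_ yV yM] /h[_ zV zM].
by apply/lfunP => v; rewrite lie_bracketE yM // (zM (y v)) // subrr zero_lfunE.
Qed.

(** For [x] mapping [U] into itself, the trace of the restriction of [x] to [U];
the definition by coordinates spares the construction of that restriction. *)
Definition trace_on (U : {vspace V}) x : F :=
  \sum_i coord (vbasis U) i (x (vbasis U)`_i).

Lemma trace_on_linear U c x y :
  trace_on U (c *: x + y) = c * trace_on U x + trace_on U y.
Proof.
rewrite /trace_on mulr_sumr -big_split; apply: eq_bigr => i _.
by rewrite add_lfunE scale_lfunE linearP.
Qed.

Lemma trace_on_comp U x y :
  (forall v, v \in U -> x v \in U) -> (forall v, v \in U -> y v \in U) ->
  trace_on U (x \o y)%VF = trace_on U (y \o x)%VF.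
Proof.
have expand x' y' : (forall v, v \in U -> y' v \in U) ->
    trace_on U (x' \o y')%VF = \sum_(i < \dim U) \sum_(k < \dim U)
      coord (vbasis U) k (y' (vbasis U)`_i) * coord (vbasis U) i (x' (vbasis U)`_k).
  move=> yU; apply: eq_bigr => i _; rewrite comp_lfunE.
  have /(coord_basis (vbasisP U)) {1}-> : y' (vbasis U)`_i \in U.
    by apply/yU/vbasis_mem/mem_nth; rewrite size_tuple.
  by rewrite !linear_sum; apply: eq_bigr => k _; rewrite !linearZ.
move=> xU yU; rewrite !expand // exchange_big.
by do 2!apply: eq_bigr => ? _; rewrite mulrC.
Qed.

(** The operators of trace zero on [U] form an ideal that contains all brackets,
so it is not zero. *)
Lemma simple_trace_on U : lie_simple L ->
  (forall y v, L y -> v \in U -> y v \in U) ->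
  forall x, L x -> trace_on U x = 0.
Proof.
move=> simL LU.
have tr_br x y : L x -> L y -> trace_on U (lie_bracket x y) = 0.
  move=> Lx Ly; rewrite /lie_bracket addrC -scaleN1r trace_on_linear mulN1r.
  by rewrite [X in _ + X]trace_on_comp ?addNr // => v; apply: LU.
have [||||h|h] := @simple_ideal F V L (fun x => L x /\ trace_on U x = 0) simL.
- by move=> x [].
- split; first exact: form_lie_algebra0.
  by rewrite /trace_on big1 // => i _; rewrite zero_lfunE linear0.
- move=> c x y [Lx x0] [Ly y0]; split; first exact: form_lie_algebra_linear.
  by rewrite trace_on_linear x0 y0 mulr0 addr0.
- by move=> x y Lx [Ly _]; split; [exact: form_lie_algebra_bracket|exact: tr_br].
- case: simL => nab _; case: nab => x y Lx Ly; apply: h.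
  by split; [exact: form_lie_algebra_bracket|exact: tr_br].
by move=> x /h[].
Qed.

(** * Gram matrices and dual bases *)

Definition nondegenerate_on U :=
  (forall v, v \in U -> (forall w, w \in U -> f v w = 0) -> v = 0).

Lemma gram_mul n (e : n.-tuple V) (c : 'rV[F]_n) j :
  (c *m gram f e) 0 j = f (\sum_i c 0 i *: e`_i) e`_j.
Proof.
rewrite mxE linear_sumlz; apply: eq_bigr => i _.
by rewrite mxE linearZl_LR.
Qed.

Lemma gram_mul_tr n (e : n.-tuple V) (c : 'rV[F]_n) j :
  (c *m (gram f e)^T) 0 j = f e`_j (\sum_i c 0 i *: e`_i).
Proof.
rewrite mxE linear_sumr; apply: eq_bigr => i _.
by rewrite !mxE linearZr_LR.
Qed.

Lemma unitmx_free n (M : 'M[F]_n) :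
  (M \in unitmx) <-> (forall c : 'rV_n, c *m M = 0 -> c = 0).
Proof.
split=> [uM c cM|M0]; first by rewrite -[c](mulmxK uM) cM mul0mx.
rewrite -row_free_unit -kermx_eq0; apply/eqP/row_matrixP => i.
by rewrite row0; apply/M0/sub_kermxP/row_sub.
Qed.

Lemma basis_sum_inj n (e : n.-tuple V) U (c : 'rV[F]_n) : basis_of U e ->
  \sum_i c 0 i *: e`_i = 0 -> c = 0.
Proof.
move=> /basis_free /freeP h c0; apply/rowP => i; rewrite mxE.
by apply: (h (fun i => c 0 i)).
Qed.

End Form.

Section Degenerate.
Variables (F : fieldType) (V : vectType F) (f : {biscalar V}).
Local Notation L := (form_lie_algebra f).
Implicit Types (x y : 'End(V)) (a b u v w : V) (U W : {vspace V}).

Lemma gram_unit n (e : n.-tuple V) U : basis_of U e -> nondegenerate_on f U ->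
  gram f e \in unitmx.
Proof.
move=> eU ndU; apply/unitmx_free => c cG; apply: (basis_sum_inj eU).
apply: ndU.
  apply: memv_suml => i _; apply: memvZ; apply: (basis_mem eU).
  by rewrite mem_nth ?size_tuple.
apply: (basis_ind eU) => [|k u v fu fv|i]; first exact: linear0r.
  by rewrite linearDr linearZr_LR /= fu fv mulr0 addr0.
by rewrite -gram_mul cG mxE.
Qed.

(** The rows of the inverse of the Gram matrix are the coordinates of the dual
basis. *)
Lemma dual_basis n (e : n.-tuple V) U : basis_of U e -> nondegenerate_on f U ->
  exists2 e' : 'I_n -> V, (forall i, e' i \in U)
    & forall i j : 'I_n, f (e' i) e`_j = (i == j)%:R.
Proof.
move=> eU ndU; have Gu := gram_unit eU ndU.
exists (fun i => \sum_k invmx (gram f e) i k *: e`_k) => [i|i j].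
  apply: memv_suml => k _; apply: memvZ; apply: (basis_mem eU).
  by rewrite mem_nth ?size_tuple.
have := gram_mul f e (row i (invmx (gram f e))) j.
rewrite -row_mul mulVmx // !mxE => ->.
by congr (f _ _); apply: eq_bigr => k _; rewrite mxE.
Qed.

(** This and [right_radical_gram] say that both radicals vanish together, because
the Gram matrix is square. *)
Lemma left_radical_gram :
  (forall v, left_radical f v -> v = 0) <-> gram f (vbasis {:V}) \in unitmx.
Proof.
split=> [nd|Gu v fv].
  by apply: (gram_unit (vbasisP _)) => v _ fv; apply: nd => w; apply/fv/memvf.
rewrite (coord_basis (vbasisP _) (memvf v)).
pose c := \row_i coord (vbasis {:V}) i v.
suff /rowP c0 : c = 0.
  by rewrite big1 // => i _; have := c0 i; rewrite !mxE => ->; rewrite scale0r.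
apply/(iffLR (unitmx_free _) Gu)/rowP => j; rewrite gram_mul mxE.
rewrite -[RHS](fv (vbasis {:V})`_j) [in RHS](coord_basis (vbasisP _) (memvf v)).
by congr (f _ _); apply: eq_bigr => i _; rewrite mxE.
Qed.

Lemma right_radical_gram :
  (forall v, right_radical f v -> v = 0) <-> gram f (vbasis {:V}) \in unitmx.
Proof.
rewrite -unitmx_tr; split=> [nd|Gu v fv].
  apply/unitmx_free => c cG; apply: (basis_sum_inj (vbasisP {:V})).
  apply: nd => w; have := memvf w; move: w.
  apply: (basis_ind (vbasisP {:V})) => [|k u v fu fv|i]; first exact: linear0l.
    by rewrite linearDl linearZl_LR /= fu fv mulr0 addr0.
  by rewrite -gram_mul_tr cG mxE.
rewrite (coord_basis (vbasisP _) (memvf v)).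
pose c := \row_i coord (vbasis {:V}) i v.
suff /rowP c0 : c = 0.
  by rewrite big1 // => i _; have := c0 i; rewrite !mxE => ->; rewrite scale0r.
apply/(iffLR (unitmx_free _) Gu)/rowP => j; rewrite gram_mul_tr mxE.
rewrite -[RHS](fv (vbasis {:V})`_j) [in RHS](coord_basis (vbasisP _) (memvf v)).
by congr (f _ _); apply: eq_bigr => i _; rewrite mxE.
Qed.

(** * Simplicity forces nondegeneracy *)

Lemma form_lie_algebra_left_radical x v :
  L x -> left_radical f v -> left_radical f (x v).
Proof. by move=> Lx fv w; rewrite Lx fv oppr0. Qed.

Lemma form_lie_algebra_right_radical x v :
  L x -> right_radical f v -> right_radical f (x v).
Proof. by move=> Lx fv w; apply: oppr_inj; rewrite -Lx fv oppr0. Qed.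

(** For [f = 0] the identity is a nonzero central element. *)
Lemma simple_form_neq0 : (0 < \dim {:V})%N -> lie_simple L ->
  ~ forall v w, f v w = 0.
Proof.
move=> V0 simL f0; have := V0.
suff -> : {:V}%VS = 0%VS by rewrite dimv0.
apply/vspaceP => v; rewrite memvf memv0; apply/esym/eqP.
have <- : \1%VF v = v by rewrite id_lfunE.
rewrite (_ : \1%VF = 0) ?zero_lfunE //; apply: (form_center simL).
  by move=> u w; rewrite !f0 oppr0.
by move=> x _; rewrite /lie_bracket comp_lfun1l comp_lfun1r subrr.
Qed.

(** For a nonzero [r] in both radicals, [rank2 r b] is the map sending [w] to
[f b w *: r], an operator of [L(f)] with image in the common radical and killing
it.  All these vanish only if [f = 0]. *)
Lemma simple_radicals : (0 < \dim {:V})%N -> lie_simple L ->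
  (forall v, left_radical f v -> right_radical f v -> v = 0).
Proof.
move=> V0 simL r rl rr; apply/eqP/negPn/negP => /eqP r0.
have [R RP] : exists R : {vspace V}, forall v,
    v \in R <-> left_radical f v /\ right_radical f v.
  apply: closed_predicate_vspace.
    by split=> w; rewrite ?linear0l ?linear0r.
  move=> c u v [ul ur] [vl vr]; split=> w.
    by rewrite linearDl linearZl_LR /= ul vl mulr0 addr0.
  by rewrite linearDr linearZr_LR /= ur vr mulr0 addr0.
apply: (simple_form_neq0 V0 simL) => b w.
have T0 : rank2 f r b = 0.
  apply: (@simple_null_ideal _ _ f R) => //.
  - move=> y v Ly /RP[vl vr]; apply/RP; split.
      exact: form_lie_algebra_left_radical.
    exact: form_lie_algebra_right_radical.
  - by apply: rank2_in => v w'; rewrite rl rr !mul0r.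
  - by move=> v; rewrite rank2E rr scale0r subr0; apply/memvZ/RP.
  - by move=> v /RP[_ vr]; rewrite rank2E rr vr !scale0r subr0.
have := rank2E f r b w; rewrite T0 zero_lfunE rr scale0r subr0.
by move=> /esym /eqP; rewrite scaler_eq0 => /orP[/eqP//|/eqP].
Qed.

(** The radicals pair to zero with each other because of the trace, and then
[rank2 a b] belongs to the null ideal of the sum of the two radicals. *)
Theorem simple_nondegenerate : (0 < \dim {:V})%N -> lie_simple L ->
  form_nondegenerate f.
Proof.
move=> V0 simL; suff Gu : gram f (vbasis {:V}) \in unitmx.
  by split; [apply/left_radical_gram|apply/right_radical_gram].
apply: NNPP => nGu.
have [a [al a0]] : exists a, left_radical f a /\ a <> 0.
  apply: NNPP => h; apply: nGu; apply/left_radical_gram => v fv.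
  by apply: NNPP => v0; apply: h; exists v.
have [b [br b0]] : exists b, right_radical f b /\ b <> 0.
  apply: NNPP => h; apply: nGu; apply/right_radical_gram => v fv.
  by apply: NNPP => v0; apply: h; exists v.
have R0 := simple_radicals V0 simL.
have [Lr LrP] : exists W : {vspace V}, forall v, v \in W <-> left_radical f v.
  apply: closed_predicate_vspace => [w|c u v ul vl w]; first by rewrite linear0l.
  by rewrite linearDl linearZl_LR /= ul vl mulr0 addr0.
have [Rr RrP] : exists W : {vspace V}, forall v, v \in W <-> right_radical f v.
  apply: closed_predicate_vspace => [w|c u v ul vl w]; first by rewrite linear0r.
  by rewrite linearDr linearZr_LR /= ul vl mulr0 addr0.
have LLr y v : L y -> v \in Lr -> y v \in Lr.
  by move=> Ly /LrP vl; apply/LrP/form_lie_algebra_left_radical.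
have LRr y v : L y -> v \in Rr -> y v \in Rr.
  by move=> Ly /RrP vl; apply/RrP/form_lie_algebra_right_radical.
have LT u v : left_radical f u -> right_radical f v -> L (rank2 f u v).
  by move=> ul vr; apply: rank2_in => v' w; rewrite ul vr mul0r mulr0.
(* [rank2 u v] acts on the left radical by [w |-> f v w *: u], which has trace
   [f v u]. *)
have pair0 u v : left_radical f u -> right_radical f v -> f v u = 0.
  move=> ul vr; rewrite -[RHS](simple_trace_on simL LLr (LT u v ul vr)).
  rewrite /trace_on (coord_basis (vbasisP Lr) (iffRL (LrP u) ul)).
  rewrite linear_sumr /=; apply: eq_bigr => i _; rewrite linearZr_LR rank2E.
  have /LrP-> : (vbasis Lr)`_i \in Lr by rewrite vbasis_mem ?mem_nth ?size_tuple.
  rewrite scale0r subr0 -(coord_basis (vbasisP Lr)) ?linearZ; last exact/LrP.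
  by rewrite mulrC.
have T0 : rank2 f a b = 0.
  apply: (@simple_null_ideal _ _ f (Lr + Rr)%VS) => //.
  - move=> y v Ly /memv_addP[u uL [w wR ->]]; rewrite linearD.
    by rewrite memv_add ?LLr ?LRr.
  - exact: LT.
  - by move=> v; rewrite rank2E memvB // memvZ ?memvE //;
      [apply: subv_trans (addvSl _ _); rewrite -memvE; apply/LrP
      |apply: subv_trans (addvSr _ _); rewrite -memvE; apply/RrP].
  - move=> _ /memv_addP[u /LrP uL [w /RrP wR ->]].
    rewrite rank2E linearDr linearDl /= (pair0 u b) // wR uL (pair0 a w) //.
    by rewrite addr0 !scale0r subr0.
(* As [rank2 a b = 0], some multiple of [b] by a nonzero scalar is proportional
   to [a], so that [b] lies in both radicals. *)
have [v fva] : exists v, f v a <> 0.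
  apply: NNPP => h; apply: a0; apply: R0 => // v.
  by apply: NNPP => fva; apply: h; exists v.
have Eab : f v a *: b = f b v *: a.
  by have := rank2E f a b v; rewrite T0 zero_lfunE => /esym/eqP; rewrite subr_eq0 => /eqP.
apply: b0; apply: R0 => // w.
apply: (mulfI (introN eqP fva)); rewrite mulr0.
rewrite -[_ * _](linearZl_LR (f : {biscalar V})) Eab.
by rewrite linearZl_LR /= al mulr0.
Qed.

End Degenerate.

(** * Simplicity forces the asymmetry to be an involution *)

Section Nondegenerate.
Variables (F : fieldType) (V : vectType F) (f : {biscalar V}).
Local Notation L := (form_lie_algebra f).
Implicit Types (x y s : 'End(V)) (a b u v w : V) (U W : {vspace V}).

(** In characteristic 2 the identity belongs to [L(f)], and it is central. *)
Lemma simple_two_neq0 : (0 < \dim {:V})%N -> lie_simple L -> (2 : F) != 0.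
Proof.
move=> V0 simL; apply/eqP => two0; have := V0.
suff -> : {:V}%VS = 0%VS by rewrite dimv0.
apply/vspaceP => v; rewrite memvf memv0; apply/esym/eqP.
have <- : \1%VF v = v by rewrite id_lfunE.
rewrite (_ : \1%VF = 0) ?zero_lfunE //; apply: (form_center simL).
  move=> u w; rewrite !id_lfunE; apply/eqP.
  by rewrite -subr_eq0 opprK -mulr2n -mulr_natl two0 mul0r.
by move=> x _; rewrite /lie_bracket comp_lfun1l comp_lfun1r subrr.
Qed.

(** The annihilator in [L(f)] of an invariant subspace is an ideal. *)
Lemma simple_annihilator U : lie_simple L ->
  (forall y v, L y -> v \in U -> y v \in U) ->
  (forall x, L x -> (forall v, v \in U -> x v = 0) -> x = 0) \/
  (forall x, L x -> forall v, v \in U -> x v = 0).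
Proof.
move=> simL LU.
have [||||h|h] := @simple_ideal F V L
  (fun x => L x /\ forall v, v \in U -> x v = 0) simL.
- by move=> x [].
- by split=> [|v _]; [exact: form_lie_algebra0|rewrite zero_lfunE].
- move=> c x y [Lx xU] [Ly yU]; split=> [|v vU].
    exact: form_lie_algebra_linear.
  by rewrite add_lfunE scale_lfunE xU ?yU // scaler0 addr0.
- move=> x y Lx [Ly yU]; split=> [|v vU]; first exact: form_lie_algebra_bracket.
  by rewrite lie_bracketE (yU v) // (yU (x v)) ?LU // linear0 subrr.
- by left=> x Lx xU; apply: h.
- by right=> x /h[].
Qed.

Lemma asymmetry_comm s x : form_nondegenerate f -> is_asymmetry f s -> L x ->
  forall v, x (s v) = s (x v).
Proof.
move=> [_ nd] sP Lx v; apply/eqP; rewrite -subr_eq0; apply/eqP/nd => w.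
by rewrite linearBr /= -sP Lx (sP (x w)) Lx opprK subrr.
Qed.

(** Since [s] preserves [f], its adjoint is its inverse, so [s - s^-1] is in
[L(f)]; it commutes with [L(f)] because [s] does. *)
Lemma simple_asymmetry_involution s : lie_simple L -> form_nondegenerate f ->
  is_asymmetry f s -> lker s == 0%VS -> forall v, s (s v) = v.
Proof.
move=> simL nd sP s0; pose t := (s^-1)%VF.
have sK v : t (s v) = v by rewrite lker0_lfunK.
have tK v : s (t v) = v by rewrite lker0_lfunVK.
have isom v w : f (s v) (s w) = f v w by rewrite -sP -sP.
have st0 : s - t = 0.
  apply: (form_center simL) => [v w|x Lx].
    rewrite !add_lfunE !opp_lfunE linearBl linearBr /= opprB.
    by rewrite -(isom v (t w)) -(isom (t v) w) !tK.
  apply/lfunP => v; rewrite lie_bracketE zero_lfunE !add_lfunE !opp_lfunE.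
  rewrite linearB /= (asymmetry_comm nd sP Lx).
  have -> : x (t v) = t (x v).
    by rewrite -[LHS]sK -(asymmetry_comm nd sP Lx) tK.
  by rewrite subrr.
by move=> v; move/eqP: st0; rewrite subr_eq0 => /eqP {1}->; rewrite sK.
Qed.

Definition eigenspace_of s (l : F) : {vspace V} := lker (s - l *: \1%VF).

Lemma eigenspace_ofP s l v : reflect (s v = l *: v) (v \in eigenspace_of s l).
Proof.
rewrite memv_ker add_lfunE opp_lfunE scale_lfunE id_lfunE subr_eq0.
exact: eqP.
Qed.

(** With [g = s - l] one has [g ^ 2 = - 2 l g], so the powers of [g] are nonzero
multiples of [g] and generalized eigenvectors are eigenvectors. *)
Lemma involution_generalized_eigenspace s l : (2 : F) != 0 -> l ^+ 2 = 1 ->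
  (forall v, s (s v) = v) ->
  is_generalized_eigenspace s l (eigenspace_of s l).
Proof.
move=> two0 l2 ss v; split=> [/eigenspace_ofP sv|].
  by exists 1%N => //=; rewrite sv subrr.
case=> -[//|m] _; set g := (fun u => _).
have gg u : g (g u) = - (2 * l) *: g u.
  have lg : l *: g u = l *: s u - u by rewrite /g scalerBr scalerA -expr2 l2 scale1r.
  rewrite scaleNr -scalerA lg {1}/g lg {1}/g linearB linearZ /= ss scaler_nat.
  by rewrite mulr2n opprB opprD !opprB.
have -> : iter m.+1 g v = (- (2 * l)) ^+ m *: g v.
  elim: m => [|m IH]; first by rewrite expr0 scale1r.
  rewrite iterS IH exprSr -scalerA -gg {1 3}/g linearZ /= !scalerBr !scalerA.
  by rewrite [l * _]mulrC.
have l0 : l != 0 by apply: contra_eq_neq l2 => ->; rewrite expr0n eq_sym oner_eq0.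
move/eqP; rewrite scaler_eq0 expf_eq0 oppr_eq0 mulf_eq0 (negPf two0) (negPf l0).
by rewrite andbF /= subr_eq0 => /eqP sv; apply/eigenspace_ofP.
Qed.

(** On [W1] the form is symmetric, on [Wm1] skew, and these are orthogonal.  When
both are nonzero and [W1] has dimension at least 2, the annihilator of [Wm1] is a
proper nonzero ideal. *)
Lemma simple_trichotomy : (0 < \dim {:V})%N -> lie_simple L ->
  form_nondegenerate f ->
  [\/ form_skew f, form_symmetric f | mixed_condition f].
Proof.
move=> V0 simL nd; have two0 := simple_two_neq0 V0 simL.
have [s sP s0] := asymmetry_exists nd.
have ss := simple_asymmetry_involution simL nd sP s0.
pose W1 := eigenspace_of s 1; pose Wm1 := eigenspace_of s (-1).
have W1P v : v \in W1 -> forall w, f v w = f w v.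
  by move=> /eigenspace_ofP; rewrite scale1r => sv w; rewrite sP sv.
have Wm1P v : v \in Wm1 -> forall w, f v w = - f w v.
  by move=> /eigenspace_ofP; rewrite scaleN1r => sv w; rewrite sP sv linearNr.
have ort v w : v \in W1 -> w \in Wm1 -> f v w = 0.
  by move=> v1 wm1; apply: (eq_opp_eq0 two0); rewrite {1}(W1P _ v1) (Wm1P _ wm1).
have ort' v w : v \in Wm1 -> w \in W1 -> f v w = 0.
  by move=> vm1 w1; rewrite (Wm1P _ vm1) ort // oppr0.
have addW : (W1 + Wm1)%VS = {:V}%VS.
  apply/eqP; rewrite eqEsubv subvf; apply/subvP => v _.
  have -> : v = 2^-1 *: (v + s v) + 2^-1 *: (v - s v).
    rewrite -scalerDr addrACA subrr addr0 -mulr2n -scaler_nat scalerA.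
    by rewrite mulVf // scale1r.
  apply: memv_add; apply: memvZ; apply/eigenspace_ofP.
    by rewrite linearD /= ss scale1r addrC.
  by rewrite linearB /= ss scaleN1r opprB.
have [W10|W1n0] := eqVneq W1 0%VS.
  apply: Or31 => v w; apply: Wm1P; have := memvf v.
  by rewrite -addW W10 add0v.
have [Wm10|Wm1n0] := eqVneq Wm1 0%VS.
  apply: Or32 => v w; apply: W1P; have := memvf v.
  by rewrite -addW Wm10 addv0.
apply: Or33; exists s, W1, Wm1; split; [|split].
- split=> //; apply: involution_generalized_eigenspace => //.
    by rewrite expr1n.
  by rewrite sqrrN expr1n.
- split=> //; apply/directv_addP; apply/eqP; rewrite -subv0; apply/subvP => v.
  rewrite memv_cap => /andP[v1 vm1]; rewrite memv0; apply/eqP.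
  case: nd => nd _; apply: nd => w; apply: (eq_opp_eq0 two0).
  by rewrite {1}(Wm1P _ vm1) (W1P _ v1).
split.
- by move=> v w v1 _; apply: W1P.
- by move=> v w vm1 _; apply: Wm1P.
- apply/eqP; rewrite eqn_leq [(0 < _)%N]lt0n dimv_eq0 W1n0 andbT leqNgt.
  apply/negP => dim2; set a := vpick W1.
  have aW : a \in W1 by exact: memv_pick.
  have a0 : a != 0 by rewrite vpick0.
  have [b bW ba] : exists2 b, b \in W1 & b \notin <[a]>%VS.
    apply: NNPP => h; have /dimvS : (W1 <= <[a]>)%VS.
      by apply/subvP => b bW; apply/negPn/negP => ba; apply: h; exists b.
    by rewrite dim_vline a0 leqNgt dim2.
  have LW y v : L y -> v \in Wm1 -> y v \in Wm1.
    move=> Ly /eigenspace_ofP sv; apply/eigenspace_ofP.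
    by rewrite -(asymmetry_comm nd sP Ly) sv linearZ.
  (* [rank2 a b] kills [Wm1] and is not zero; the second case says that [L(f)]
     kills [Wm1], but [rank2 u u] with [u] in [Wm1] does not. *)
  have [h|h] := simple_annihilator simL LW.
    have T0 : rank2 f a b = 0.
      apply: h; first by apply: rank2_in => v w; rewrite !(W1P _ aW) (W1P _ bW).
      by move=> v vm1; rewrite rank2E ort // ort' // !scale0r subr0.
    case/negP: a0; apply/eqP; case: nd => _ nd; apply: nd => v.
    apply/eqP; apply: contraNT ba => fva; apply/vlineP.
    exists ((f v a)^-1 * f b v); have := rank2E f a b v.
    rewrite T0 zero_lfunE => /esym/eqP; rewrite subr_eq0 => /eqP Eab.
    by rewrite -scalerA Eab scalerA mulVf // scale1r.
  set u := vpick Wm1; have uW : u \in Wm1 by exact: memv_pick.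
  have u0 : u != 0 by rewrite vpick0.
  case/negP: (u0); apply/eqP; case: nd => nd _; apply: nd => v.
  have /memv_addP[v1 v1W [v2 v2W ->]] : v \in (W1 + Wm1)%VS by rewrite addW memvf.
  rewrite linearDr /= ort' // add0r; apply: (eq_opp_eq0 two0); rewrite -(Wm1P _ v2W).
  have LTu : L (rank2 f u u) by apply: rank2_in => v' w; rewrite !(Wm1P _ uW); ring.
  have := h _ LTu _ v2W; rewrite rank2E -scalerBl => /eqP.
  by rewrite scaler_eq0 (negPf u0) orbF subr_eq0 => /eqP.
- by rewrite lt0n dimv_eq0.
Qed.

End Nondegenerate.

(** * Symplectic algebras *)

Section Symplectic.
Variables (F : fieldType) (V : vectType F) (f : {biscalar V}).
Hypothesis two0 : (2 : F) != 0.
Local Notation L := (form_lie_algebra f).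
Local Notation T := (rank2 f).
Implicit Types (x y : 'End(V)) (a b c u v w : V) (U W : {vspace V}).

(** For dual bases [e] and [e'] of [U], [2 x] is the sum of the
[rank2 (x e_i) (e'_i)].  Allowing [U] to be smaller than [V] covers forms whose
algebra acts on a summand only. *)
Lemma rank2_span U (eps : F) (I : {vspace 'End(V)}) : eps ^+ 2 = 1 ->
  (forall u, u \in U -> forall w, f u w = eps * f w u) ->
  nondegenerate_on f U -> (forall x v, L x -> x v \in U) ->
  (forall a b, a \in U -> b \in U -> T a b \in I) ->
  forall x, L x -> x \in I.
Proof.
move=> eps2 fU ndU LU TI x Lx; set e := vbasis U.
have eU i : (i < \dim U)%N -> e`_i \in U.
  by move=> lti; rewrite vbasis_mem ?mem_nth ?size_tuple.
have [e' e'U e'P] := dual_basis (vbasisP U) ndU.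
have expand u : u \in U -> \sum_(i < \dim U) f u e`_i *: e' i = u.
  move=> uU; apply/eqP; rewrite -subr_eq0; apply/eqP.
  have dU : \sum_(i < \dim U) f u e`_i *: e' i - u \in U.
    by rewrite memvB // memv_suml // => i _; rewrite memvZ.
  apply: (ndU _ dU); apply: (basis_ind (vbasisP U)) => [|k v w fv fw|j].
  - exact: linear0r.
  - by rewrite linearDr linearZr_LR /= fv fw mulr0 addr0.
  rewrite linearBl linear_sumlz (bigD1 j) //= linearZl_LR /= e'P eqxx mulr1.
  rewrite big1 ?addr0 ?subrr // => i ij.
  by rewrite linearZl_LR /= e'P (negPf ij) mulr0.
have proj v : x (\sum_(i < \dim U) f (e' i) v *: e`_i) = x v.
  set p := \sum_i _; have fp u : u \in U -> f u p = f u v.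
    move=> uU; rewrite -(expand u uU) !linear_sumlz; apply: eq_bigr => i _.
    rewrite !linearZl_LR /=; congr (_ * _).
    rewrite linear_sumr (bigD1 i) //= linearZr_LR /= e'P eqxx mulr1.
    rewrite big1 ?addr0 // => j ji.
    by rewrite linearZr_LR /= e'P eq_sym (negPf ji) mulr0.
  apply/eqP; rewrite -subr_eq0; apply/eqP; apply: ndU; first by rewrite memvB ?LU.
  move=> w wU; rewrite fU ?memvB ?LU // linearBr /= -[f w (x p)]opprK -Lx.
  by rewrite -[f w (x v)]opprK -Lx fp ?LU // subrr mulr0.
have -> : x = 2^-1 *: \sum_(i < \dim U) T (x e`_i) (e' i).
  apply/lfunP => v; rewrite scale_lfunE sum_lfunE.
  under eq_bigr => i _ do rewrite rank2E -scaleNr -Lx.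
  rewrite big_split /= expand ?LU //.
  have -> : \sum_(i < \dim U) f (e' i) v *: x e`_i = x v.
    by rewrite -proj linear_sum; apply: eq_bigr => i _; rewrite linearZ.
  by rewrite -mulr2n -scaler_nat scalerA mulVf // scale1r.
by rewrite memvZ // memv_suml // => i _; apply: TI => //; apply: LU.
Qed.

(** In characteristic not 2, a nonzero [x] in an ideal has some [a] with
[f (x a) a] nonzero, since the form [f (x v) w] is symmetric.  Bracketing [x] twice
with [T a a] gives a multiple of [T a a] by this scalar, up
to a factor that is a power of 2 and a sign.  Bracketing twice with
[T b b] passes from [T a a] to [T b b] if [f b a] is nonzero, and the other
[T b b] and the [T b c] follow by polarization. *)
Lemma symplectic_simple U : (0 < \dim U)%N ->
  (forall u, u \in U -> forall w, f u w = - f w u) ->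
  nondegenerate_on f U -> (forall x v, L x -> x v \in U) -> lie_simple L.
Proof.
move=> U0 fU ndU LU.
have scale_inj k (W : vectType F) (w : W) (I : {vspace W}) :
    k != 0 -> k *: w \in I -> w \in I.
  by move=> k0 /(memvZ k^-1); rewrite scalerA mulVf // scale1r.
have fvv v : v \in U -> f v v = 0.
  by move=> vU; apply: (eq_opp_eq0 two0); apply: fU.
have TL a b : a \in U -> b \in U -> L (T a b).
  by move=> aU bU; apply: rank2_in => v w; rewrite (fU a) // (fU b) // mulrNN.
have Tsym a b : a \in U -> b \in U -> T a b = T b a.
  move=> aU bU; apply/lfunP => v; rewrite !rank2E.
  by rewrite (fU b) // (fU a) // !scaleNr addrC.
have TTaa a b : a \in U -> b \in U -> T b b a = (2 * f b a) *: b.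
  move=> aU bU; rewrite rank2E (fU a) // scaleNr opprK -scalerDl.
  by congr (_ *: _); rewrite mulr_natl mulr2n.
have brS a b : a \in U -> b \in U ->
    lie_bracket (T b b) (T a a) = (2 * (2 * f b a)) *: T b a.
  move=> aU bU; rewrite rank2_bracket; last exact: TL.
  rewrite TTaa // rank2Zl rank2Zr (Tsym a b) // -mulr2n -scaler_nat scalerA.
  by [].
have brT a b : a \in U -> b \in U ->
    lie_bracket (T b b) (T b a) = (2 * f b a) *: T b b.
  move=> aU bU; rewrite rank2_bracket; last exact: TL.
  by rewrite !TTaa // fvv // mulr0 scale0r rank2_0l add0r rank2Zr.
have partner a : a \in U -> a != 0 -> exists2 b, b \in U & f b a != 0.
  move=> aU a0; apply: NNPP => h; case/eqP: a0; apply: ndU aU _ => b bU.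
  by apply/eqP; apply: contraT => fab; case: h; exists b; rewrite // fU // oppr_eq0.
split.
  move=> ab; set a := vpick U.
  have aU : a \in U by exact: memv_pick.
  have a0 : a != 0 by rewrite vpick0 -dimv_eq0 -lt0n.
  have [b bU fba] := partner a aU a0.
  have := ab _ _ (TL b b bU bU) (TL a a aU aU); rewrite brS // => /eqP.
  rewrite scaler_eq0 !mulf_eq0 (negPf two0) (negPf fba) /= => /eqP Tba.
  have := rank2E f b a a; rewrite Tba zero_lfunE fvv // scale0r add0r => /esym/eqP.
  by rewrite oppr_eq0 scaler_eq0 (negPf a0) orbF fU // oppr_eq0 (negPf fba).
move=> I [IL Ibr]; have [->|I0] := eqVneq I 0%VS; [by left|right].
set x := vpick I; have xI : x \in I by exact: memv_pick.
have x0 : x != 0 by rewrite vpick0.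
have Lx := IL x xI.
have [a aU fxa] : exists2 a, a \in U & f (x a) a != 0.
  apply: NNPP => h; case/eqP: x0; have q0 a : a \in U -> f (x a) a = 0.
    by move=> aU; apply/eqP; apply: contraT => fa; case: h; exists a.
  have xU a : a \in U -> x a = 0.
    move=> aU; apply: ndU; first exact: LU.
    move=> b bU; have := q0 (a + b) (memvD aU bU).
    have -> : x (a + b) = x a + x b by rewrite linearD.
    rewrite linearDl !linearDr /= !q0 // addr0 add0r (Lx b a).
    rewrite -(fU (x a)) ?LU // -mulr2n -mulr_natl => /eqP.
    by rewrite mulf_eq0 (negPf two0) => /eqP.
  apply/lfunP => v; rewrite zero_lfunE; apply: ndU; first exact: LU.
  by move=> w wU; rewrite Lx xU // linear0r oppr0.
have a0 : a != 0 by apply: contraNneq fxa => ->; rewrite linear0r.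
have TxaI : T (x a) a \in I.
  have := Ibr _ _ (TL a a aU aU) xI; rewrite lie_bracketC rank2_bracket // memvN.
  rewrite (Tsym a) ?LU // -mulr2n -scaler_nat; exact: scale_inj.
have TaI : T a a \in I.
  have := Ibr _ _ (TL a a aU aU) TxaI; rewrite rank2_bracket; last exact: TL.
  rewrite !TTaa ?LU // fvv // mulr0 scale0r rank2_0r addr0 rank2Zl.
  apply: scale_inj; rewrite mulf_neq0 //.
  by rewrite fU // oppr_eq0.
have near b : b \in U -> f b a != 0 -> T b b \in I.
  move=> bU fba; have := Ibr _ _ (TL b b bU bU) TaI; rewrite brS // => /scale_inj h.
  have /(Ibr _ _ (TL b b bU bU)) : T b a \in I by apply: h; rewrite !mulf_neq0.
  by rewrite brT //; apply: scale_inj; rewrite mulf_neq0.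
have [b bU fba] := partner a aU a0.
have TI c : c \in U -> T c c \in I.
  move=> cU; have [fca|] := eqVneq (f c a) 0; last exact: near.
  (* The parallelogram identity, as [c + b] and [c - b] are not orthogonal to [a]. *)
  have := near (c + b) (memvD cU bU); have := near (c - b) (memvB cU bU).
  rewrite linearBl linearDl /= fca !add0r oppr_eq0 => /(_ fba) h1 /(_ fba) h2.
  have := memvD h1 h2; have /= bI := near b bU fba.
  rewrite -[- b]scaleN1r !rank2Al !rank2Ar !rank2Zl !rank2Zr scalerA mulrNN mulr1.
  rewrite !scaleN1r scale1r addrACA [T c c - _ + _]addrACA [- _ + _ + _]addrACA.
  rewrite !addNr addr0 add0r (rpredDr _ (memvD bI bI)) -mulr2n -scaler_nat.
  exact: scale_inj.
have TabI c d : c \in U -> d \in U -> T c d \in I.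
  move=> cU dU; apply: (scale_inj _ _ _ _ two0).
  have := TI (c + d) (memvD cU dU); rewrite rank2Al !rank2Ar (Tsym d c) //.
  have cI := TI c cU; have dI := TI d dU.
  by rewrite addrA rpredDr // -addrA rpredDl // -mulr2n scaler_nat.
apply: (@rank2_span U (-1)) => //; first by rewrite sqrrN expr1n.
by move=> u uU w; rewrite fU // mulN1r.
Qed.

End Symplectic.

(** * Orthogonal algebras *)

Section Orthogonal.
Variables (F : fieldType) (V : vectType F) (f : {biscalar V}).
Hypothesis two0 : (2 : F) != 0.
Local Notation L := (form_lie_algebra f).
Implicit Types (x y : 'End(V)) (a b u v w : V) (U W : {vspace V}).

(** Gram-Schmidt: by polarization a form that is not zero on [U] has an anisotropic
vector in [U], which splits off. *)
Lemma orthogonal_basis U : form_symmetric f ->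
  exists2 e : seq V, basis_of U e & pairwise (fun u v => f u v == 0) e.
Proof.
move=> fC; have [n] := ubnP (\dim U); elim: n U => // n IH U /ltnSE leUn.
have [f0|/not_all_ex_not[a]] := classic (forall u, u \in U -> f u u = 0).
  exists (vbasis U); first exact: vbasisP.
  have fU u v : u \in U -> v \in U -> f u v = 0.
    move=> uU vU; have := f0 _ (memvD uU vU).
    rewrite linearDl !linearDr /= !f0 // addr0 add0r (fC v) -mulr2n -mulr_natl.
    by move/eqP; rewrite mulf_eq0 (negPf two0) => /eqP.
  have /allP eU : all (mem U) (vbasis U) by apply/allP => u; apply: vbasis_mem.
  elim: (tval _) eU => //= u s IHs eU; rewrite IHs ?andbT.
    by apply/allP => v vs; rewrite fU // eU ?mem_head // mem_behead.
  by move=> v vs; rewrite eU // mem_behead.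
move=> /(@imply_to_and (a \in U)) [aU /eqP faa].
have [U' U'P] : exists W : {vspace V}, forall v, v \in W <-> v \in U /\ f a v = 0.
  apply: closed_predicate_vspace; first by rewrite mem0v linear0r.
  move=> c u v [uU fu] [vU fv]; rewrite memvD ?memvZ //; split=> //.
  by rewrite linearDr linearZr_LR /= fu fv mulr0 addr0.
have a0 : a != 0 by apply: contraNneq faa => ->; rewrite linear0r.
have dU : (<[a]> :&: U')%VS = 0%VS.
  apply/eqP; rewrite -subv0; apply/subvP => v; rewrite memv_cap.
  move=> /andP[/vlineP[c ->] /U'P[_]]; rewrite linearZr_LR /= => /eqP.
  by rewrite mulf_eq0 (negPf faa) orbF => /eqP->; rewrite scale0r mem0v.
have UE : U = (<[a]> + U')%VS.
  apply/eqP; rewrite eqEsubv; apply/andP; split.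
    apply/subvP => u uU; rewrite -[u](subrK ((f a u / f a a) *: a)) addrC.
    apply: memv_add; first by rewrite memvZ ?memv_line.
    apply/U'P; rewrite memvB ?memvZ //; split=> //.
    by rewrite linearBr linearZr_LR /= mulfVK ?subrr.
  apply/subvP => _ /memv_addP[_ /vlineP[c ->] [u /U'P[uU _] ->]].
  by rewrite memvD ?memvZ.
have [|e eU' eO] := IH U'.
  by apply: leq_trans leUn; rewrite UE dimv_disjoint_sum // dim_vline a0.
exists (a :: e).
  rewrite -cat1s UE cat_basis ?seq1_basis //.
  by apply/directv_addP.
rewrite /= eO andbT; apply/allP => v ve; apply/eqP.
by have /U'P[] : v \in U' by apply: (basis_mem eU').
Qed.

Section OrthogonalBasis.
Hypothesis fC : form_symmetric f.
Hypothesis nd : form_nondegenerate f.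
Variables (n : nat) (e : n.-tuple V).
Hypothesis eB : basis_of {:V} e.
Hypothesis eO : forall i j : 'I_n, i != j -> f e`_i e`_j = 0.
Implicit Types i j k p q r s : 'I_n.
Local Notation d i := (f e`_i e`_i).
Local Notation T i j := (rank2 f e`_i e`_j).

(** Up to the scalars [d j] these are the matrix coefficients of [x]; membership
in [L(f)] says that this array is skew. *)
Definition entry x i j := f (x e`_i) e`_j.

Lemma symmetric_rank2_in a b : L (rank2 f a b).
Proof. by apply: rank2_in => v w; rewrite (fC a) (fC b). Qed.

Lemma gram_entry i j : f e`_i e`_j = (i == j)%:R * d i.
Proof. by case: eqVneq => [->|/eO->]; rewrite ?mul1r ?mul0r. Qed.

Lemma form_ext u v : (forall i, f u e`_i = f v e`_i) -> u = v.
Proof.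
move=> uv; apply/eqP; rewrite -subr_eq0; apply/eqP; case: nd => nd' _.
apply: nd' => w; have := memvf w; move: w.
apply: (basis_ind eB) => [|c w w' fw fw'|i]; first exact: linear0r.
  by rewrite linearDr linearZr_LR /= fw fw' mulr0 addr0.
by rewrite linearBl /= uv subrr.
Qed.

Lemma diag_neq0 i : d i != 0.
Proof.
apply/eqP => di; have : e`_i = 0.
  apply: form_ext => j; rewrite linear0l gram_entry.
  by rewrite di mulr0.
by apply/eqP/(free_not0 (basis_free eB)); rewrite mem_nth ?size_tuple.
Qed.

Lemma lfun_basis_ext x y : (forall i, x e`_i = y e`_i) -> x = y.
Proof.
move=> xy; apply/lfunP => v; have := memvf v; move: v.
apply: (basis_ind eB) => [|c u v xu xv|//]; first by rewrite !linear0.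
by rewrite !linearD !linearZ /= xu xv.
Qed.

Lemma entry_ext x y : (forall i j, entry x i j = entry y i j) -> x = y.
Proof. by move=> xy; apply: lfun_basis_ext => i; apply: form_ext => j; apply: xy. Qed.

Lemma entry_skew x i j : L x -> entry x j i = - entry x i j.
Proof. by move=> Lx; rewrite /entry Lx fC. Qed.

Lemma entry_diag x i : L x -> entry x i i = 0.
Proof.
by move=> Lx; apply: (eq_opp_eq0 two0); apply: entry_skew.
Qed.

Lemma entry_linear c x y i j : entry (c *: x + y) i j = c * entry x i j + entry y i j.
Proof. by rewrite /entry add_lfunE scale_lfunE linearDl linearZl_LR. Qed.

Lemma entry0 i j : entry 0 i j = 0.
Proof. by rewrite /entry zero_lfunE linear0l. Qed.

Lemma coord_expand v : v = \sum_(i < n) (f v e`_i / d i) *: e`_i.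
Proof.
apply: form_ext => j; rewrite linear_sumlz (bigD1 j) //=.
rewrite linearZl_LR /= mulfVK ?diag_neq0 //.
by rewrite big1 ?addr0 // => i ij; rewrite linearZl_LR /= (eO ij) mulr0.
Qed.

Lemma form_expand u v : f u v = \sum_(k < n) f u e`_k * f v e`_k / d k.
Proof.
rewrite {1}(coord_expand u) linear_sumlz; apply: eq_bigr => k _.
by rewrite linearZl_LR /= (fC _ v) mulrAC.
Qed.

Lemma entry_bracket x y i j : L x -> L y ->
  entry (lie_bracket x y) i j =
  \sum_(k < n) (entry x i k * entry y j k - entry y i k * entry x j k) / d k.
Proof.
move=> Lx Ly; rewrite /entry lie_bracketE linearBl /= (Lx (y _)) (Ly (x _)) opprK.
rewrite addrC (form_expand (x _)) (form_expand (y _)) -sumrB.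
by apply: eq_bigr => k _; rewrite mulrBl.
Qed.

Lemma rank2_basis i j k :
  T i j e`_k = ((k == j)%:R * d j) *: e`_i - ((k == i)%:R * d i) *: e`_j.
Proof.
rewrite rank2E (gram_entry j k) (gram_entry k i) eq_sym.
by congr (_ - _ *: _); case: eqVneq => [->|]; rewrite ?mul0r.
Qed.

Lemma entry_rank2 p q i j :
  entry (T p q) i j = (i == q)%:R * d q * ((p == j)%:R * d p)
                    - (i == p)%:R * d p * ((q == j)%:R * d q).
Proof.
by rewrite /entry rank2_basis linearBl /= !linearZl_LR /= !(gram_entry _ j).
Qed.

Lemma entry_bracket_rank2 p q x i j : L x ->
  entry (lie_bracket (T p q) x) i j =
    (j == p)%:R * d p * entry x i q - (j == q)%:R * d q * entry x i p
  - (i == q)%:R * d q * entry x p j + (i == p)%:R * d p * entry x q j.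
Proof.
move=> Lx; rewrite {1}/entry lie_bracketE linearBl /= symmetric_rank2_in.
have -> : x (T p q e`_i) = ((i == q)%:R * d q) *: x e`_p - ((i == p)%:R * d p) *: x e`_q.
  by rewrite rank2_basis linearB !linearZ.
rewrite rank2_basis linearBr linearBl /= !linearZr_LR !linearZl_LR /=.
rewrite -/(entry x i p) -/(entry x i q) -/(entry x p j) -/(entry x q j); ring.
Qed.

(** The pair [{i, j}] meets the pair [pq] in exactly one index. *)
Definition separates i j (pq : 'I_n * 'I_n) :=
  ((i == pq.1) || (i == pq.2)) (+) ((j == pq.1) || (j == pq.2)).

(** [ad (T p q)] kills the [T i j] with [{i, j}] equal to or disjoint from
[{p, q}]; on the others, [T p q] acts on one of the two vectors only, through a
map of square [- (d p * d q)] on the plane of [e_p] and [e_q]. *)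
Lemma entry_bracket2 p q x i j : L x -> p != q ->
  entry (lie_bracket (T p q) (lie_bracket (T p q) x)) i j =
  if separates i j (p, q) then - (d p * d q) * entry x i j else 0.
Proof.
move=> Lx pq; have LTx : L (lie_bracket (T p q) x).
  by apply: form_lie_algebra_bracket => //; apply: symmetric_rank2_in.
rewrite entry_bracket_rank2 // !(entry_bracket_rank2 p q _ _ Lx) /separates /=.
rewrite !eqxx (negPf pq) [q == p]eq_sym (negPf pq) /=.
have := entry_diag p Lx; have := entry_diag q Lx; have := entry_skew p q Lx.
have [->|ip] := eqVneq i p; have [->|jp] := eqVneq j p;
rewrite ?(negPf pq) ?[q == p]eq_sym ?(negPf pq) /=;
try have [->|iq] := eqVneq i q; try have [->|jq] := eqVneq j q;
rewrite ?eqxx /= => -> -> ->; ring.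
Qed.

Lemma exists_fresh (s : seq 'I_n) : (size s < n)%N -> exists k, k \notin s.
Proof.
move=> sn; apply: NNPP => h; move: sn; rewrite ltnNge -[X in (X <= _)%N]card_ord.
have -> // : (#|'I_n| <= size s)%N.
apply: leq_trans (card_size s); apply: subset_leq_card; apply/subsetP => k _.
by apply/negPn/negP => ks; apply: h; exists k.
Qed.

Lemma rank2_anti a b : rank2 f a b = - rank2 f b a.
Proof. by apply/lfunP => v; rewrite opp_lfunE !rank2E opprB (fC v a) (fC b v). Qed.

Lemma bracket_common k p q : k != p -> p != q -> k != q ->
  lie_bracket (T k q) (T p q) = d q *: T p k.
Proof.
move=> kp pq kq; rewrite rank2_bracket; last exact: symmetric_rank2_in.
rewrite !rank2_basis eqxx (negPf pq) [p == k]eq_sym (negPf kp).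
rewrite [q == k]eq_sym (negPf kq) !mul0r !scale0r !subr0 rank2_0l add0r.
by rewrite mul1r rank2Zr.
Qed.

Section Ideal.
Variables (I : {vspace 'End(V)}).
Hypothesis II : lie_ideal L I.

Lemma ideal_bracket p q x : x \in I -> lie_bracket (T p q) x \in I.
Proof. by case: II => _ Ibr xI; apply: Ibr xI; apply: symmetric_rank2_in. Qed.

(** By [entry_bracket2], erasing all entries that some pair of [ks] does not
separate keeps the element in the ideal, up to a nonzero scalar. *)
Lemma ideal_filter (ks : seq ('I_n * 'I_n)) x : x \in I ->
  {in ks, forall pq, pq.1 != pq.2} ->
  exists2 y, y \in I & exists2 c, c != 0 &
    forall i j, entry y i j = if all (separates i j) ks then c * entry x i j else 0.
Proof.
move=> xI; elim: ks => [_|[p q] ks IH ks_ne].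
  by exists x => //; exists 1; rewrite ?oner_neq0 // => i j; rewrite mul1r.
have [|y yI [c c0 yE]] := IH; first by move=> pq pqks; apply: ks_ne; rewrite mem_behead.
have pq : p != q := ks_ne (p, q) (mem_head _ _).
exists (lie_bracket (T p q) (lie_bracket (T p q) y)); first by rewrite !ideal_bracket.
exists (- (d p * d q) * c); first by rewrite mulf_neq0 // oppr_eq0 mulf_neq0 ?diag_neq0.
move=> i j; rewrite entry_bracket2 //=; last by case: II => h _; apply: h.
by case: ifP => //= _; rewrite yE; case: ifP => _; rewrite ?mulr0 ?mulrA.
Qed.

(** Starting from [entry x p q] nonzero, filter by all pairs [{p, k}] and [{q, k}]
with [k] not in [{p, q}].  An entry [i j] survives if [{i, j} = {p, q}], or if
[{i, j}] is disjoint from [{p, q}] and contains all those [k]. *)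
Lemma ideal_edge x : x \in I -> x != 0 ->
  exists p q y, [/\ p != q, y \in I, entry y p q != 0 &
    forall i j, entry y i j != 0 ->
      (i, j) \in [:: (p, q); (q, p)] \/
      [/\ i != j, i \notin [:: p; q], j \notin [:: p; q]
         & forall k, k \in [:: p; q; i; j]]].
Proof.
move=> xI x0; have IL : forall y, y \in I -> L y by case: II.
have Lx := IL x xI.
have [p [q xpq]] : exists p q, entry x p q != 0.
  apply: NNPP => h; case/eqP: x0; apply: entry_ext => i j.
  rewrite entry0; apply/eqP.
  by apply: contraT => xij; case: h; exists i, j.
have pq : p != q by apply: contraNneq xpq => ->; rewrite entry_diag.
pose ks := [seq (p, k) | k <- enum 'I_n & k \notin [:: p; q]] ++
           [seq (q, k) | k <- enum 'I_n & k \notin [:: p; q]].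
have ksP k : k \notin [:: p; q] -> (p, k) \in ks /\ (q, k) \in ks.
  move=> kpq; rewrite !mem_cat; split; apply/orP; [left|right];
  by apply/mapP; exists k => //; rewrite mem_filter kpq mem_enum.
have [|y yI [c c0 yE]] := ideal_filter (ks := ks) xI.
  move=> _ /[!mem_cat] /orP[] /mapP[k + ->] /=;
  by rewrite mem_filter !inE negb_or => /andP[/andP[kp kq] _]; rewrite eq_sym.
exists p, q, y; split=> //.
  rewrite yE ifT ?mulf_neq0 //; apply/allP => _ /[!mem_cat] /orP[] /mapP[k + ->];
  rewrite mem_filter !inE negb_or => /andP[/andP[kp kq] _];
  rewrite /separates /= !eqxx ?[q == p]eq_sym (negPf pq) /=.
    by rewrite [q == k]eq_sym (negPf kq).
  by rewrite [p == k]eq_sym (negPf kp).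
move=> i j yij; have sep : all (separates i j) ks.
  by apply: contraNT yij => /negPf h; rewrite yE h.
have ij : i != j by apply: contraNneq yij => ->; rewrite entry_diag ?eqxx //; apply: IL.
have sepP k : k \notin [:: p; q] -> separates i j (p, k) /\ separates i j (q, k).
  by move=> /ksP[h1 h2]; move/allP: sep => sep; rewrite !sep.
have [ipq|ipq] := boolP (i \in [:: p; q]).
  left; have [jpq|/sepP] := boolP (j \in [:: p; q]).
    move: ipq jpq ij; rewrite !inE !xpair_eqE => /orP[] /eqP-> /orP[] /eqP->;
    by rewrite !eqxx ?orbT.
  rewrite /separates /= !eqxx !orbT !addbT.
  by move: ipq; rewrite !inE => /orP[] /eqP->; rewrite eqxx => -[].
have [jpq|jpq] := boolP (j \in [:: p; q]).
  have [] := sepP i ipq; rewrite /separates /= !eqxx !orbT /=.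
  by move: jpq; rewrite !inE => /orP[] /eqP->; rewrite eqxx.
right; split=> // k; have [kpq|kpq] := boolP (k \in [:: p; q]).
  by rewrite -[[:: p; q; i; j]]/([:: p; q] ++ [:: i; j]) mem_cat kpq.
have [+ _] := sepP k kpq; rewrite /separates /=.
move: ipq jpq; rewrite !inE !negb_or => /andP[/negPf-> /negPf iq].
move=> /andP[/negPf-> /negPf jq] /=.
by rewrite [k == i]eq_sym [k == j]eq_sym; do 2!case: (_ == k); rewrite ?orbT.
Qed.

(** The element [y] of [ideal_edge] is a multiple of [T p q], or else the dimension
is 4 and [y = al *: T p q + be *: T r s].  In that case the brackets with
[T q r] and [T p s] are two combinations of [T p r] and [T q s], and they are
proportional only if the product of the [d i] is a square. *)
Lemma ideal_rank2 x : x \in I -> x != 0 -> (2 < n)%N ->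
  (n = 4%N -> ~ is_square (\prod_(i < n) d i)) ->
  exists p q, p != q /\ T p q \in I.
Proof.
move=> xI x0 n3 disc.
have [p [q [y [pq yI ypq ysupp]]]] := ideal_edge xI x0.
have Ly : L y by case: II => h _; apply: h.
have rank1 : (forall i j, entry y i j != 0 -> (i, j) \in [:: (p, q); (q, p)]) ->
    T p q \in I.
  move=> supp; have -> : T p q = (- (d p * d q) / entry y p q) *: y + 0.
    apply: entry_ext => i j; rewrite entry_linear entry0 addr0.
    rewrite entry_rank2; have [|yij] := boolP ((i, j) \in [:: (p, q); (q, p)]).
      rewrite !inE !xpair_eqE => /orP[] /andP[/eqP-> /eqP->];
      rewrite !eqxx ?[q == p]eq_sym (negPf pq).
        by rewrite mulfVK //=; ring.
      by rewrite (entry_skew p q Ly) mulrN mulfVK //=; ring.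
    have /eqP-> : entry y i j == 0 by apply: contraNT yij => /supp.
    move: yij; rewrite !inE !xpair_eqE ![_ == j]eq_sym mulr0.
    do 2![case: (_ == _); rewrite ?mul0r ?mul1r ?subr0 ?oppr0 //=];
    by do 2![case: (_ == _); rewrite ?mul0r ?mul1r ?mulr0 ?subr0 ?oppr0 //=].
  by rewrite addr0 memvZ.
have [/rank1|] := classic (forall i j, entry y i j != 0 -> (i, j) \in [:: (p, q); (q, p)]).
  by exists p, q.
move=> /not_all_ex_not[r /not_all_ex_not[s /(@imply_to_and (_ != 0))[yrs /negP rspq]]].
have [/(negP rspq)//|[rs rpq spq cover]] := ysupp r s yrs.
have pq_rs : [&& r != p, r != q, s != p & s != q].
  by move: rpq spq; rewrite !inE !negb_or => /andP[-> ->] /andP[-> ->].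
case/and4P: pq_rs => rp rq sp sq.
have pqrs : uniq [:: p; q; r; s].
  rewrite /= !inE !negb_or [p == r]eq_sym [p == s]eq_sym [q == r]eq_sym [q == s]eq_sym.
  by rewrite pq rp rq sp sq rs.
have prod_d : \prod_(i < n) d i = d p * d q * (d r * d s).
  rewrite (perm_big [:: p; q; r; s]) /=; first by rewrite !big_cons big_nil mulr1 !mulrA.
  by apply: uniq_perm; rewrite ?index_enum_uniq // => k; rewrite mem_index_enum cover.
have n4 : n = 4%N.
  rewrite -[LHS]card_ord -[RHS]/(size [:: p; q; r; s]) -(card_uniqP pqrs).
  by apply: eq_card => k; rewrite cover.
have y_off i j : i \in [:: p; q] -> j \in [:: r; s] -> entry y i j = 0 /\ entry y j i = 0.
  move=> ipq jrs; have yij : entry y i j = 0.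
    apply/eqP/negPn/negP => /ysupp[|[_ /negP//]].
    move: jrs; rewrite !inE !xpair_eqE => /orP[] /eqP->.
      by rewrite (negPf rp) (negPf rq) !andbF.
    by rewrite (negPf sp) (negPf sq) !andbF.
  by rewrite (entry_skew i j Ly) yij oppr0.
have [[ypr yrp] [yps ysp] [yqr yrq] [yqs ysq]] : [/\ entry y p r = 0 /\ entry y r p = 0,
   entry y p s = 0 /\ entry y s p = 0, entry y q r = 0 /\ entry y r q = 0
   & entry y q s = 0 /\ entry y s q = 0].
  by split; apply: y_off; rewrite !inE eqxx ?orbT.
set al := - entry y p q / (d p * d q); set be := - entry y r s / (d r * d s).
have al0 : al != 0 by rewrite mulf_neq0 ?invr_eq0 ?oppr_eq0 ?mulf_neq0 ?diag_neq0.
have neq2 i j : i != j -> ((i == j) = false) * ((j == i) = false).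
  by move=> /negPf ij; split; rewrite // eq_sym.
have neqs := (neq2 _ _ pq, neq2 _ _ rp, neq2 _ _ rq, neq2 _ _ sp, neq2 _ _ sq, neq2 _ _ rs).
have yE : y = al *: T p q + (be *: T r s + 0).
  have d0 := (diag_neq0 p, diag_neq0 q, diag_neq0 r, diag_neq0 s).
  apply: entry_ext => i j; rewrite !entry_linear entry0 addr0 !entry_rank2 /al /be.
  move: (cover i) (cover j); rewrite !inE => /or4P[] /eqP-> /or4P[] /eqP->;
  rewrite ?eqxx ?neqs ?ypr ?yrp ?yps ?ysp ?yqr ?yrq ?yqs ?ysq ?(entry_diag _ Ly) /=;
  rewrite ?(entry_skew p q Ly) ?(entry_skew r s Ly) ?mul0r ?mulr0 ?subrr ?mulr0 ?addr0 //;
  by field; rewrite ?d0.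
(* The combination of the two brackets that eliminates [T q s]. *)
have y1I := ideal_bracket q r yI; have y2I := ideal_bracket p s yI.
have y1E : lie_bracket (T q r) y = (- (al * d q)) *: T p r + (be * d r) *: T q s.
  rewrite yE addr0 lie_bracketDr !lie_bracketZr; congr (_ + _).
    rewrite rank2_bracket; last exact: symmetric_rank2_in.
    rewrite !rank2_basis eqxx !neqs !mul0r !scale0r subr0 rank2_0l !add0r mul1r.
    by rewrite -scaleNr rank2Zr scalerA mulrN.
  rewrite rank2_bracket; last exact: symmetric_rank2_in.
  rewrite !rank2_basis eqxx !neqs !mul0r !scale0r !subr0 rank2_0r addr0 mul1r.
  by rewrite rank2Zl scalerA.
have y2E : lie_bracket (T p s) y = (al * d p) *: T q s - (be * d s) *: T p r.
  rewrite yE addr0 lie_bracketDr !lie_bracketZr; congr (_ + _).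
    rewrite rank2_bracket; last exact: symmetric_rank2_in.
    rewrite !rank2_basis eqxx !neqs !mul0r !scale0r subr0 rank2_0r addr0 sub0r mul1r.
    by rewrite -scaleNr rank2Zl rank2_anti scalerN scaleNr opprK scalerA.
  rewrite rank2_bracket; last exact: symmetric_rank2_in.
  rewrite !rank2_basis eqxx !neqs !mul0r !scale0r !subr0 rank2_0l add0r mul1r.
  by rewrite rank2Zr rank2_anti scalerN scalerN scalerA.
have zI : (be ^+ 2 * (d r * d s) - al ^+ 2 * (d p * d q)) *: T p r \in I.
  have -> : (be ^+ 2 * (d r * d s) - al ^+ 2 * (d p * d q)) *: T p r =
      (al * d p) *: lie_bracket (T q r) y - (be * d r) *: lie_bracket (T p s) y.
    rewrite y1E y2E scalerDr scalerBr !scalerA opprB addrACA [X in X *: T q s - _]mulrC.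
    by rewrite subrr addr0 -scalerDl; congr (_ *: _); ring.
  by rewrite memvB ?memvZ.
have [c0|c0] := eqVneq (be ^+ 2 * (d r * d s) - al ^+ 2 * (d p * d q)) 0; last first.
  exists p, r; split; first by rewrite eq_sym.
  move/(memvZ (be ^+ 2 * (d r * d s) - al ^+ 2 * (d p * d q))^-1): zI.
  by rewrite scalerA mulVf // scale1r.
case: (disc n4); exists (be / al * (d r * d s)); rewrite prod_d.
have -> : d p * d q = be ^+ 2 * (d r * d s) / al ^+ 2.
  by move/eqP: c0; rewrite subr_eq0 => /eqP->; field.
by field.
Qed.
(** [[T k q, T p q] = d q *: T p k] moves the second index freely, and
[T q p = - T p q] then moves the first one. *)
Lemma ideal_rank2_all p q : p != q -> T p q \in I -> forall a b, rank2 f a b \in I.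
Proof.
have step p' q' k : p' != q' -> T p' q' \in I -> T p' k \in I.
  move=> pq TI; have [->|kq] := eqVneq k q'; first by [].
  have [->|kp] := eqVneq k p'.
    have -> : T p' p' = 0 by apply/lfunP => v; rewrite rank2E zero_lfunE (fC v) subrr.
    exact: mem0v.
  have := ideal_bracket k q' TI; rewrite bracket_common //.
  by move/(memvZ (d q')^-1); rewrite scalerA mulVf ?diag_neq0 // scale1r.
move=> pq TI; have TijI i j : T i j \in I.
  have [->|ip] := eqVneq i p; first exact: step TI.
  apply: (step i p) => //; rewrite rank2_anti memvN; exact: step TI.
move=> a b; have := memvf a; move: a; apply: (basis_ind eB) => [|k u v uI vI|i].
- by rewrite rank2_0l mem0v.
- by rewrite rank2Dl memvD ?memvZ.
have := memvf b; move: b; apply: (basis_ind eB) => [|k u v uI vI|j //].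
- by rewrite rank2_0r mem0v.
- by rewrite rank2Dr memvD ?memvZ.
Qed.

End Ideal.

Lemma orthogonal_simple : (2 < n)%N ->
  (n = 4%N -> ~ is_square (\prod_(i < n) d i)) -> lie_simple L.
Proof.
move=> n3 disc; split.
  have [p _] := exists_fresh (s := [::]) (ltnW (ltnW n3)).
  have [q] := exists_fresh (s := [:: p]) (ltnW n3).
  rewrite inE => qp; have [r] := exists_fresh (s := [:: p; q]) n3.
  rewrite !inE negb_or => /andP[rp rq] ab.
  have := ab _ _ (symmetric_rank2_in e`_r e`_q) (symmetric_rank2_in e`_p e`_q).
  rewrite bracket_common // 1?eq_sym // => /eqP.
  rewrite scaler_eq0 (negPf (diag_neq0 q)) => /eqP Tpr.
  have := entry_rank2 p r r p; rewrite Tpr entry0 !eqxx (negPf rp) /= => /esym/eqP.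
  by rewrite !mul1r !mul0r subr0 mulf_eq0 !(negPf (diag_neq0 _)).
move=> I II; have [->|I0] := eqVneq I 0%VS; [by left|right].
have xI : vpick I \in I by exact: memv_pick.
have x0 : vpick I != 0 by rewrite vpick0.
have [p [q [pq TI]]] := ideal_rank2 II xI x0 n3 disc.
apply: (@rank2_span _ _ f two0 {:V}%VS 1); rewrite ?expr1n //.
- by move=> u _ w; rewrite mul1r.
- move=> v _ fv; case: nd => nd' _; apply: nd' => w; exact/fv/memvf.
- by move=> *; rewrite memvf.
- by move=> a b _ _; apply: (ideal_rank2_all II pq TI).
Qed.

(** An entry [i j] of a bracket is a sum over [k] of products of entries [i k]
and [j k]; for two indices one of these is diagonal, hence zero. *)
Lemma orthogonal_abelian : (n <= 2)%N -> lie_abelian L.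
Proof.
move=> n2 x y Lx Ly; apply: entry_ext => i j; rewrite entry0.
have [->|ij] := eqVneq i j; first by rewrite entry_diag //; apply: form_lie_algebra_bracket.
rewrite entry_bracket // big1 // => k _.
have /orP[/eqP->|/eqP->] : (k == i) || (k == j).
- apply/negPn/negP; rewrite negb_or => /andP[ki kj].
  have /card_uniqP/= cd : uniq [:: k; i; j] by rewrite /= !inE negb_or ki kj ij.
  by have := max_card (mem [:: k; i; j]); rewrite cd card_ord leqNgt ltnS n2.
- by rewrite !(entry_diag _ Lx) !(entry_diag _ Ly) !mul0r subrr mul0r.
- by rewrite !(entry_diag _ Lx) !(entry_diag _ Ly) !mulr0 subrr mul0r.
Qed.

(** The three equations say that the skew array [entry x] is an eigenvector, for
the eigenvalue [c], of the Hodge star of [f]; brackets with members of [L(f)]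
commute with the Hodge star, so this eigenspace is an ideal. *)
Lemma orthogonal4_not_simple : n = 4%N -> is_square (\prod_(i < n) d i) -> ~ lie_simple L.
Proof.
move=> n4 [c cE] simL.
have fresh (t : seq 'I_n) : (size t < 4)%N -> exists k, k \notin t.
  by rewrite -n4; apply: exists_fresh.
have [p _] := fresh [::] isT; have [q] := fresh [:: p] isT.
have [r rpq] := fresh [:: p; q] isT; have [s] := fresh [:: p; q; r] isT.
move: rpq; rewrite !inE !negb_or => /andP[rp rq] /and3P[sp sq sr] qp.
have neq2 i j : i != j -> ((i == j) = false) * ((j == i) = false).
  by move=> /negPf ij; split; rewrite // eq_sym.
have neqs := (neq2 _ _ qp, neq2 _ _ rp, neq2 _ _ rq, neq2 _ _ sp, neq2 _ _ sq, neq2 _ _ sr).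
have perm_pqrs : perm_eq (index_enum 'I_n) [:: p; q; r; s].
  have pqrs : uniq [:: p; q; r; s] by rewrite /= !inE !neqs.
  apply: uniq_perm; rewrite ?index_enum_uniq // => k; rewrite mem_index_enum.
  apply/esym/(subset_cardP _ (subset_predT _)).
  by rewrite (card_uniqP pqrs) card_ord.
have dE : d p * d q * (d r * d s) = c ^+ 2.
  by rewrite -cE (perm_big _ perm_pqrs) /= !big_cons big_nil mulr1 !mulrA.
have c0 : c != 0 by rewrite -sqrf_eq0 -dE !mulf_neq0 ?diag_neq0.
have d0 := (diag_neq0 p, diag_neq0 q, diag_neq0 r, diag_neq0 s).
have [||||h|h] := @simple_ideal F V L (fun x => L x /\
  [/\ d r * d s * entry x p q = c * entry x r s,
      d q * d s * entry x p r = - c * entry x q s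
    & d q * d r * entry x p s = c * entry x q r]) simL.
- by move=> x [].
- by split; [exact: form_lie_algebra0|rewrite !entry0 !mulr0].
- move=> k x y [Lx [x1 x2 x3]] [Ly [y1 y2 y3]].
  split; first exact: form_lie_algebra_linear.
  by split; rewrite !entry_linear !mulrDr ![_ * (k * _)]mulrCA ?x1 ?x2 ?x3 ?y1 ?y2 ?y3.
- move=> x y Lx [Ly [y1 y2 y3]]; split; first exact: form_lie_algebra_bracket.
  have sum4 i j : entry (lie_bracket x y) i j =
     (entry x i p * entry y j p - entry y i p * entry x j p) / d p
   + ((entry x i q * entry y j q - entry y i q * entry x j q) / d q
   + ((entry x i r * entry y j r - entry y i r * entry x j r) / d r
   + (entry x i s * entry y j s - entry y i s * entry x j s) / d s)).
    by rewrite entry_bracket // (perm_big _ perm_pqrs) /= !big_cons big_nil addr0.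
  have {}y1 : entry y p q = c * entry y r s / (d r * d s) by rewrite -y1; field; rewrite ?d0.
  have {}y2 : entry y p r = - c * entry y q s / (d q * d s) by rewrite -y2; field; rewrite ?d0.
  have {}y3 : entry y p s = c * entry y q r / (d q * d r) by rewrite -y3; field; rewrite ?d0.
  have {dE} dE : d p = c ^+ 2 / (d q * d r * d s) by rewrite -dE; field; rewrite ?d0.
  have skew z i j (Lz : L z) := entry_skew i j Lz.
  rewrite !sum4 !(entry_diag _ Lx) !(entry_diag _ Ly).
  rewrite ?(skew x p q) ?(skew x p r) ?(skew x p s) ?(skew x q r) ?(skew x q s) ?(skew x r s) //.
  rewrite ?(skew y p q) ?(skew y p r) ?(skew y p s) ?(skew y q r) ?(skew y q s) ?(skew y r s) //.
  rewrite y1 y2 y3 dE; split; field; rewrite ?d0 ?c0 //.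
(* The ideal is not zero: it contains [z], which is the self-dual combination of
   [T p q] and [T r s]. *)
- pose z := c *: T p q + (d p * d q) *: T r s.
  have Lz : L z.
    apply: form_lie_algebra_linear; first exact: symmetric_rank2_in.
    by apply: form_lie_algebraZ; apply: symmetric_rank2_in.
  have zE i j : entry z i j = c * entry (T p q) i j + d p * d q * entry (T r s) i j.
    by rewrite entry_linear -[_ *: T r s]addr0 entry_linear entry0 addr0.
  have z0 : z = 0.
    by apply: h; split=> //; split; rewrite !zE !entry_rank2 !eqxx !neqs /=; ring.
  have := zE p q; rewrite z0 entry0 !entry_rank2 !eqxx !neqs /= => /esym/eqP.
  rewrite !(mul0r, mul1r, sub0r, oppr0, mulr0, addr0, mulrN) oppr_eq0.
  by rewrite !mulf_eq0 (negPf c0) !(negPf (diag_neq0 _)).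
(* Nor is it everything: it does not contain [T p q]. *)
have [_ [+ _ _]] := h _ (symmetric_rank2_in e`_p e`_q).
rewrite !entry_rank2 !eqxx !neqs /= => /eqP.
rewrite !mul0r !mul1r !sub0r ?oppr0 !mulr0.
by rewrite mulrN oppr_eq0 !mulf_eq0 !(negPf (diag_neq0 _)).
Qed.

End OrthogonalBasis.
End Orthogonal.

(** * The classification *)

Section Classification.
Variables (F : fieldType) (V : vectType F) (f : {biscalar V}).
Local Notation L := (form_lie_algebra f).

Lemma orthogonal_tuple : (2 : F) != 0 -> form_symmetric f ->
  exists2 e : (\dim {:V}).-tuple V, basis_of {:V} e
    & forall i j : 'I_(\dim {:V}), i != j -> f e`_i e`_j = 0.
Proof.
move=> two0 fC; have [e eB /(pairwiseP 0) eO] := orthogonal_basis two0 {:V} fC.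
have se : size e == \dim {:V} by rewrite -(eqnP (basis_free eB)) (span_basis eB).
exists (Tuple se) => // i j ij /=.
have lt k : (k < \dim {:V})%N -> k \in gtn (size e) by rewrite inE (eqP se).
wlog ltij : i j ij / (i < j)%N.
  move=> h; have [/h->//|] := ltnP i j.
  rewrite leq_eqVlt [_ == _ :> nat]eq_sym => /orP[/eqP/val_inj/eqP|/h].
    by rewrite (negPf ij).
  by rewrite fC eq_sym => ->.
by apply/eqP; apply: eO => //; apply: lt.
Qed.

(** The Gram matrix of an orthogonal basis is diagonal. *)
Lemma discriminant_orthogonal (e : (\dim {:V}).-tuple V) : basis_of {:V} e ->
  (forall i j : 'I_(\dim {:V}), i != j -> f e`_i e`_j = 0) ->
  is_square (\prod_(i < \dim {:V}) f e`_i e`_i) <-> is_square (discriminant f).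
Proof.
move=> eB eO; have [c c0] := discriminant_basis f eB.
have -> : gram f e = diag_mx (\row_i f e`_i e`_i).
  apply/matrixP => i j; rewrite !mxE; case: eqVneq => [->//|/eO->//].
rewrite det_diag; under eq_bigr do rewrite mxE.
move=> ->; split=> [[b bE]|[b ->]]; last by exists (c * b); rewrite exprMn.
by exists (b / c); rewrite expr_div_n -bE mulrAC mulfV ?mul1r // expf_neq0.
Qed.

Lemma skew_symmetric_trivial v : (2 : F) != 0 -> form_nondegenerate f ->
  (forall w, f v w = f w v) -> (forall w, f v w = - f w v) -> v = 0.
Proof.
move=> two0 [nd _] fs fk; apply: nd => w; apply: (eq_opp_eq0 two0).
by rewrite {2}fs -fk.
Qed.

Lemma symmetric_simple : (2 : F) != 0 -> form_nondegenerate f ->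
  symmetric_condition f -> lie_simple L.
Proof.
move=> two0 nd [fC dim3 disc]; have [e eB eO] := orthogonal_tuple two0 fC.
apply: (orthogonal_simple two0 fC nd eB eO dim3) => dim4.
by move/(discriminant_orthogonal eB eO); apply: disc.
Qed.

Lemma simple_symmetric : (2 : F) != 0 -> form_nondegenerate f -> form_symmetric f ->
  lie_simple L -> symmetric_condition f.
Proof.
move=> two0 nd fC simL; have [e eB eO] := orthogonal_tuple two0 fC.
split=> // [|dim4].
  rewrite ltnNge; apply/negP => /(orthogonal_abelian two0 fC nd eB eO).
  by case: simL.
move/(discriminant_orthogonal eB eO).
by move/(orthogonal4_not_simple two0 fC nd eB eO dim4); apply.
Qed.

(** Orthogonality of the summands turns symmetry of [f] on [W1], and skewness on
[Wm1], into identities against all of [V]. *)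
Lemma mixed_decomposition : (2 : F) != 0 -> mixed_condition f ->
  exists W1 Wm1 : {vspace V},
    [/\ (W1 + Wm1)%VS = {:V}%VS, \dim W1 = 1%N, (0 < \dim Wm1)%N,
        forall v, v \in W1 -> forall w, f v w = f w v
      & forall v, v \in Wm1 -> forall w, f v w = - f w v].
Proof.
move=> two0 [s [W1 [Wm1 [_ [[addW _ f1m1 fm11] [f1 fm1 d1 dm1]]]]]].
exists W1, Wm1; split=> // v vW w.
  have /memv_addP[w1 w1W [w2 w2W ->]] : w \in (W1 + Wm1)%VS by rewrite addW memvf.
  by rewrite linearDl linearDr /= (f1 v w1) // (f1m1 v w2) // (fm11 w2 v).
have /memv_addP[w1 w1W [w2 w2W ->]] : w \in (W1 + Wm1)%VS by rewrite addW memvf.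
by rewrite linearDl linearDr /= (fm1 v w2) // (f1m1 w1 v) // (fm11 v w1) // !add0r.
Qed.

(** [L(f)] is the symplectic algebra of [Wm1]: it preserves both summands, because
they consist of the vectors at which [f] is symmetric, respectively skew, and it
kills [W1], because there [x] acts by a scalar [k] with [k * f v v = 0]. *)
Lemma mixed_simple : (2 : F) != 0 -> form_nondegenerate f ->
  mixed_condition f -> lie_simple L.
Proof.
move=> two0 nd /(mixed_decomposition two0)[W1 [Wm1 [addW d1 dm1 f1 fm1]]].
have ort v w : v \in W1 -> w \in Wm1 -> f v w = 0.
  by move=> v1 wm1; apply: (eq_opp_eq0 two0); rewrite {1}(f1 _ v1) (fm1 _ wm1).
have split_v v : exists2 v1, v1 \in W1 & exists2 v2, v2 \in Wm1 & v = v1 + v2.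
  have /memv_addP[v1 v1W [v2 v2W ->]] : v \in (W1 + Wm1)%VS by rewrite addW memvf.
  by exists v1 => //; exists v2.
have W1P v : (forall w, f v w = f w v) -> v \in W1.
  have [v1 v1W [v2 v2W ->]] := split_v v => fv.
  rewrite memvD // (_ : v2 = 0) ?mem0v //.
  apply: (skew_symmetric_trivial two0 nd) => w; last exact: fm1.
  have := fv w; rewrite linearDl linearDr /= (f1 v1) //; exact: addrI.
have Wm1P v : (forall w, f v w = - f w v) -> v \in Wm1.
  have [v1 v1W [v2 v2W ->]] := split_v v => fv.
  rewrite memvD // (_ : v1 = 0) ?mem0v //.
  apply: (skew_symmetric_trivial two0 nd) => w; first exact: f1.
  have := fv w; rewrite linearDl linearDr /= (fm1 v2) // opprD; exact: addIr.
apply: (symplectic_simple two0 dm1 fm1).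
  move=> v vW fv; case: nd => nd _; apply: nd => w.
  have [w1 w1W [w2 w2W ->]] := split_v w.
  by rewrite linearDr /= (fv w2) // (fm1 v) // (ort w1 v) // oppr0 addr0.
move=> x v Lx; have [v1 v1W [v2 v2W ->]] := split_v v.
rewrite linearD /= memvD //; last first.
  by apply: Wm1P => w; rewrite Lx fm1 // opprK -[f (x w) _]opprK -Lx opprK.
have xv1W : x v1 \in W1.
  by apply: W1P => w; rewrite Lx f1 // -[f w (x v1)]opprK -Lx.
have W1E : W1 = <[v1]>%VS \/ v1 = 0.
  have [->|v10] := eqVneq v1 0; [by right|left].
  by apply/esym/eqP; rewrite eqEdim -memvE v1W dim_vline v10 d1.
have [W1E'|->] := W1E; last by rewrite linear0 mem0v.
move: xv1W; rewrite {1}W1E' => /vlineP[c xv1].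
suff -> : x v1 = 0 by rewrite mem0v.
case: (nd) => nd' _; apply: nd' => w; have [w1 w1W [w2 w2W ->]] := split_v w.
have xW : x v1 \in W1 by rewrite xv1 memvZ.
rewrite linearDr /= [X in _ + X]ort // addr0.
move: w1W; rewrite W1E' => /vlineP[k ->]; rewrite linearZr_LR /=.
suff -> : f (x v1) v1 = 0 by rewrite mulr0.
by apply: (eq_opp_eq0 two0); rewrite {1}Lx -(f1 _ xW).
Qed.

Lemma skew_simple : (0 < \dim {:V})%N -> (2 : F) != 0 -> form_nondegenerate f ->
  form_skew f -> lie_simple L.
Proof.
move=> V0 two0 [nd _] fk; apply: (symplectic_simple two0 V0) => [u _ w|v _ fv|x v _].
- exact: fk.
- by apply: nd => w; apply/fv/memvf.
- exact: memvf.
Qed.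

(** Any two of the conditions make [f] symmetric and skew at the same nonzero
vector. *)
Lemma conditions_exclusive : (0 < \dim {:V})%N -> (2 : F) != 0 -> form_nondegenerate f ->
  [/\ ~ (form_skew f /\ symmetric_condition f),
      ~ (form_skew f /\ mixed_condition f)
    & ~ (symmetric_condition f /\ mixed_condition f)].
Proof.
move=> V0 two0 nd.
have no_vector (U : {vspace V}) : (0 < \dim U)%N ->
    ~ (forall v, v \in U -> forall w, f v w = f w v /\ f v w = - f w v).
  move=> U0 fU; move: U0; rewrite lt0n dimv_eq0 -vpick0 => /eqP; apply.
  by apply: (skew_symmetric_trivial two0 nd) => w; apply fU; apply: memv_pick.
split.
- by case=> fk [fC _ _]; apply: (no_vector _ V0) => v _ w; split.
- case=> fk /(mixed_decomposition two0)[W1 [Wm1 [_ d1 _ f1 _]]].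
  by apply: (no_vector W1) => [|v vW w]; [rewrite d1|split; [exact: f1|exact: fk]].
- case=> [[fC _ _]] /(mixed_decomposition two0)[W1 [Wm1 [_ _ dm1 _ fm1]]].
  by apply: (no_vector Wm1) => // v vW w; split; [exact: fC|exact: fm1].
Qed.

End Classification.

Theorem theorem11p2 (F : fieldType) (V : vectType F) (f : {biscalar V})
    (V_neq0 : (0 < \dim {:V})%N) :
  lie_simple (form_lie_algebra f) <->
  [/\ 2%N \notin [pchar F],
      form_nondegenerate f
    & exactly_one_of_three
        (form_skew f)
        (symmetric_condition f)
        (mixed_condition f)].
Proof.
have pcharE : (2%N \notin [pchar F]) = ((2 : F) != 0) by rewrite inE.
split=> [simL|[]].
  have two0 := simple_two_neq0 V_neq0 simL.
  have nd := simple_nondegenerate V_neq0 simL.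
  have [n12 n13 n23] := conditions_exclusive V_neq0 two0 nd.
  split; rewrite ?pcharE //.
  have [fk|fC|fm] := simple_trichotomy V_neq0 simL nd.
  - by apply: Or31; split=> // h; [apply: n12|apply: n13].
  - have fs := simple_symmetric two0 nd fC simL.
    by apply: Or32; split=> // h; [apply: n12|apply: n23].
  - by apply: Or33; split=> // h; [apply: n13|apply: n23].
rewrite pcharE => two0 nd [[fk _ _]|[_ fs _]|[_ _ fm]].
- exact: skew_simple.
- exact: symmetric_simple.
- exact: mixed_simple.
Qed.
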